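(* Let $n\ge 3$ and $t$ be such that either $t\in\{1,2\}$ and $n\equiv 1\pmod 4$, or $t=3$ and $n\equiv 3\pmod 4$, or $t\in\{n,2n\}$ and $n$ is odd. Set $v=6n+t$. Then the number of pairwise non-isomorphic simple $3$-gonal biembeddings of $K_{\frac{6n+t}{t}\times t}$ into orientable surfaces is at least $$\frac{2^{n/2}}{9n^2}\;\approx\;\begin{cases}2^{v/12+o(v)} & \text{if } t\in\{1,2,3\};\\ 2^{v/14+o(v)} & \text{if } t=n;\\ 2^{v/16+o(v)} & \text{if } t=2n.\end{cases}$$
   Context: $K_{m\times t}$ is the complete multipartite graph with $m$ parts of size $t$. Embeddings. For a graph $\Gamma$ let $D(\Gamma)$ be its set of oriented edges $(x,y)$ and $N(\Gamma,x)$ the neighbourhood of $x$. A (combinatorial) embedding of a connected graph $\Gamma$ into an orientable surface is a pair $\Pi=(\Gamma,\rho)$ with $\rho:D(\Gamma)\to D(\Gamma)$ such that, for each vertex $x$, $\rho(x,y)=(x,\rho_x(y))$ for $y\in N(\Gamma,x)$, where $\rho_x$ is a cyclic permutation of $N(\Gamma,x)$ of order $|N(\Gamma,x)|$; this is equivalent to a cellular embedding of $\Gamma$ in an orientable surface. The faces are the circuits obtained by face tracing, i.e. the orbits of $(x,y)\mapsto (y,\rho_y(x))$ on $D(\Gamma)$; the length of a face is its number of edges. The embedding is $3$-gonal if all faces have length $3$; simple if every face is a cycle (no repeated vertex); a biembedding if its faces can be 2-coloured so that the two faces incident with each edge have different colours. Embeddings $(\Gamma,\rho)$ and $(\Gamma',\rho')$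 are isomorphic if there is a graph isomorphism $\sigma:\Gamma\to\Gamma'$ (acting on oriented edges by $\sigma(x,y)=(\sigma(x),\sigma(y))$) such that either $\sigma\circ\rho=\rho'\circ\sigma$ on all of $D(\Gamma)$ or $\sigma\circ\rho=(\rho')^{-1}\circ\sigma$ on all of $D(\Gamma)$. $f\approx g$ means that $f/g$ tends to $1$, here as $n\to\infty$. *)

(* Defs.v *)
From HB Require Import structures.
From mathcomp Require Import all_boot all_order all_algebra all_fingroup.
From mathcomp Require Import boolp classical_sets reals topology normedtype.
From mathcomp Require Import landau sequences exp.

Set Implicit Arguments.
Unset Strict Implicit.
Unset Printing Implicit Defensive.

Import Order.TTheory GRing.Theory Num.Theory.
Import numFieldNormedType.Exports.

Record sgraph := SGraph {
  svertex :> finType;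
  sedge : rel svertex;
  sedge_sym : symmetric sedge;
  sedge_irr : irreflexive sedge
}.

Definition nbhd (G : sgraph) (x : G) : {set G} := [set y : G | sedge x y].

Definition sconnected (G : sgraph) : Prop :=
  forall x y : G, connect (@sedge G) x y.

Definition dart (G : sgraph) := {d : G * G | sedge d.1 d.2}.
HB.instance Definition _ (G : sgraph) := Finite.on (dart G).

Section Dart.
Variable G : sgraph.

Definition dtail (d : dart G) : G := (sval d).1.
Definition dhead (d : dart G) : G := (sval d).2.

Lemma drev_subproof (d : dart G) : sedge (dhead d, dtail d).1 (dhead d, dtail d).2.
Proof. by rewrite /= sedge_sym; exact: (svalP d). Qed.

Definition drev (d : dart G) : dart G := exist _ (dhead d, dtail d) (drev_subproof d).

Lemma drevK : involutive drev.
Proof. by case=> -[x y] xy; exact: val_inj. Qed.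

Definition drev_perm : {perm dart G} := perm (inv_inj drevK).

End Dart.

Section Embedding.
Variables (G : sgraph) (rho : {perm dart G}).

(* An embedding of the fixed graph G is identified with its rotation rho;
   rho is always a bijection of the darts, so it is given as a permutation. *)
Definition is_embedding : Prop :=
  sconnected G /\
  forall x : G, exists rho_x : {perm G},
    [/\ perm_on (nbhd x) rho_x,
        forall y, y \in nbhd x -> porbit rho_x y = nbhd x
      & forall d : dart G, dtail d = x -> sval (rho d) = (x, rho_x (dhead d))].

(* Permutations compose from left to right: this maps (x, y) to
   rho (y, x) = (y, rho_y x). *)
Definition face_tracing : {perm dart G} := (drev_perm G * rho)%g.

Definition faces : {set {set dart G}} := porbits face_tracing.

Definition face_of (d : dart G) : {set dart G} := porbit face_tracing d.

Definition is_kgonal (k : nat) : Prop := forall F, F \in faces -> #|F| = k.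

(* The vertices met along a face, with multiplicity, are the tails of its
   darts. *)
Definition is_simple : Prop :=
  forall F, F \in faces -> {in F &, injective (@dtail G)}.

Definition is_biembedding : Prop :=
  exists c : {set dart G} -> bool,
    forall d : dart G, c (face_of d) != c (face_of (drev d)).

End Embedding.

Record giso (G H : sgraph) := GIso {
  giso_fun :> G -> H;
  giso_bij : bijective giso_fun;
  giso_edge : forall x y, sedge (giso_fun x) (giso_fun y) = sedge x y
}.

Section DartMap.
Variables (G H : sgraph) (s : giso G H).

Lemma giso_dart_subproof (d : dart G) :
  sedge (s (dtail d), s (dhead d)).1 (s (dtail d), s (dhead d)).2.
Proof. by rewrite /= giso_edge; exact: (svalP d). Qed.

Definition giso_dart (d : dart G) : dart H :=
  exist _ (s (dtail d), s (dhead d)) (giso_dart_subproof d).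

End DartMap.

Definition emb_iso (G H : sgraph)
    (rho : {perm dart G}) (rho' : {perm dart H}) : Prop :=
  exists s : giso G H,
    (forall d, giso_dart s (rho d) = rho' (giso_dart s d)) \/
    (forall d, giso_dart s (rho d) = (rho'^-1)%g (giso_dart s d)).

Lemma emb_iso_refl (G : sgraph) (r : {perm dart G}) : emb_iso r r.
Proof.
pose s := @GIso G G id (Bijective (fun x => erefl) (fun x => erefl))
                (fun x y => erefl).
by exists s; left => d; rewrite (_ : giso_dart s =1 id) //;
  last (move=> d'; apply: val_inj; rewrite /=; by case: d' => -[]);
  rewrite (_ : giso_dart s d = d) //; apply: val_inj; case: d => -[].
Qed.

Lemma emb_iso_sym (G H : sgraph) (r : {perm dart G}) (r' : {perm dart H}) :
  emb_iso r r' -> emb_iso r' r.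
Proof.
case=> s rr'; case: (giso_bij s) => g sK gK.
have ge x y : sedge (g x) (g y) = sedge x y by rewrite -(giso_edge s) !gK.
pose s' := GIso (Bijective gK sK) ge.
have s'K : cancel (giso_dart s) (giso_dart s').
  by case=> -[x y] xy; apply: val_inj; rewrite /= /dtail /dhead /= !sK.
have sK' : cancel (giso_dart s') (giso_dart s).
  by case=> -[x y] xy; apply: val_inj; rewrite /= /dtail /dhead /= !gK.
exists s'; case: rr' => rr'; [left|right] => d; apply: (can_inj s'K).
  by rewrite sK' rr' sK'.
by rewrite sK'; apply: (@perm_inj _ (r'^-1)%g); rewrite -rr' permKV permK sK'.
Qed.

Lemma emb_iso_trans (G H K : sgraph) (r : {perm dart G})
    (r' : {perm dart H}) (r'' : {perm dart K}) :
  emb_iso r r' -> emb_iso r' r'' -> emb_iso r r''.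
Proof.
case=> s rr' [s' r'r''].
have e x y : sedge (s' (s x)) (s' (s y)) = sedge x y by rewrite !giso_edge.
pose s'' := GIso (bij_comp (giso_bij s') (giso_bij s)) e.
have sE d : giso_dart s'' d = giso_dart s' (giso_dart s d) by exact: val_inj.
have inv (f : dart H -> dart K) (p : {perm dart H}) (q : {perm dart K}) :
  (forall d, f (p d) = q (f d)) -> forall d, f ((p^-1)%g d) = (q^-1)%g (f d).
  by move=> pq d; apply: (@perm_inj _ q); rewrite -pq !permKV.
exists s''; case: rr' r'r'' => rr' [] r'r''; [left|right|right|left] => d;
  rewrite !sE rr'.
- by rewrite r'r''.
- by rewrite r'r''.
- by rewrite (inv _ _ _ r'r'').
- by rewrite (inv _ _ _ r'r'') invgK.
Qed.

Definition iso_relb (G : sgraph) : rel {perm dart G} :=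
  fun rho rho' => `[< emb_iso rho rho' >].

Lemma iso_relb_equiv (G : sgraph) (A : {set {perm dart G}}) :
  {in A & &, equivalence_rel (@iso_relb G)}.
Proof.
move=> r1 r2 r3 _ _ _; split; first exact/asboolP/emb_iso_refl.
move/asboolP=> r12; apply/asboolP/asboolP => [r13|r23].
  exact: emb_iso_trans (emb_iso_sym r12) r13.
exact: emb_iso_trans r12 r23.
Qed.

Definition nb_iso_classes (G : sgraph) (P : {perm dart G} -> Prop) : nat :=
  #|equivalence_partition (@iso_relb G) [set rho | `[< P rho >]]|.

Lemma multipartite_sym (m t : nat) :
  symmetric (fun x y : 'I_m * 'I_t => x.1 != y.1).
Proof. by move=> x y; rewrite eq_sym. Qed.

Lemma multipartite_irr (m t : nat) :
  irreflexive (fun x y : 'I_m * 'I_t => x.1 != y.1).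
Proof. by move=> x; rewrite eqxx. Qed.

Definition complete_multipartite (m t : nat) : sgraph :=
  SGraph (@multipartite_sym m t) (@multipartite_irr m t).

Definition simple_3gonal_biembedding (G : sgraph) (rho : {perm dart G}) : Prop :=
  [/\ is_embedding rho, is_simple rho, is_kgonal rho 3 & is_biembedding rho].

Definition admissible (n t : nat) : Prop :=
  [\/ (t = 1 \/ t = 2) /\ n = 1 %[mod 4],
      t = 3 /\ n = 3 %[mod 4]
    | (t = n \/ t = 2 * n) /\ odd n].

Local Open Scope ring_scope.
Local Open Scope classical_set_scope.

Section Asymptotics.
Variable R : realType.

Definition asymp_equiv (f g : nat -> R) : Prop :=
  (fun n => f n / g n) @ \oo --> (1 : R).

Definition lower_bound (n : nat) : R := 2 `^ (n%:R / 2) / (9 * n%:R ^+ 2).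

(* f n is equivalent to 2 ^ (v / c + o(v)), where v = v(n), as n -> oo; the
   o(v) is the value at v of a function e with e(w) / w -> 0 as w -> oo. *)
Definition equiv_exp2 (f : nat -> R) (v : nat -> nat) (c : R) : Prop :=
  exists e : nat -> R,
    e =o_\oo (fun w : nat => w%:R : R) /\
    asymp_equiv f (fun n => 2 `^ ((v n)%:R / c + e (v n))).

End Asymptotics.

(* Main.v *)
Require Import Defs.
From mathcomp Require Import all_boot all_order all_algebra all_fingroup.
From mathcomp Require Import boolp reals topology normedtype.
From mathcomp Require Import landau sequences exp.
From mathcomp Require Import zify ring lra.

Set Implicit Arguments.
Unset Strict Implicit.
Unset Printing Implicit Defensive.

Import Order.TTheory GRing.Theory Num.Theory.
Import numFieldNormedType.Exports.

(** The rotations counted here are invariant under a cyclic group acting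
    regularly on the vertices. Let v = 6n + t, m = v / t, and identify the
    vertices of the graph with Z_v so that two of them are adjacent when their
    difference is not a multiple of m. Suppose that half of the 6n non-multiples
    of m, one from each pair +-x, are arranged in an array whose rows and
    columns are triples of sum 0. Choose a cyclic order of each row and each
    column, giving permutations wr and wc of the cells, and rotate around every
    vertex by x |-> - wr x, - x |-> wc x, differences being taken from that
    vertex. All faces are then triangles, coming from the columns on one side
    of the 2-colouring and from the rows on the other, and the rotation is one
    cycle exactly when the composite of wr and wc is ([drot_biembedding3]).

    The arrays have three nonempty cyclic diagonals. Zero sums in the rows and
    columns force the diagonals to be b_(j-1), b_j + K and
    - (b_(j-1) + b_j + K) for a cyclic sequence b of odd length n and a
    constant K, so an array is a choice of b and K ([entry]). If t is n or 2n,
    arithmetic progressions modulo 7n or 8n do ([arithmetic_bound]); if t is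
    1, 2 or 3, the sequence b is made of four interleaved runs of consecutive
    integers ([quarters_bound]).

    Every orientation of the rows extends to one for which the composite is a
    single cycle ([unicellular]). Multiplying a permutation by a 3-cycle merges
    the three cycles through its points if these are distinct, and, if the
    permutation is one cycle, keeps it so for one of the two orientations of
    the 3-cycle. Columns 1, 3, ..., n - 2 join the other rows, two at a
    time, to the cycle formed by row 0; each remaining column is then oriented
    suitably. This gives 2 ^ n rotations.

    If a rotation r0 is isomorphic to an invariant rotation r, some isomorphism
    s fixes a base vertex. For the generating translation T, the conjugate of T
    by s is then an automorphism of r0, hence determined by the image
    of one dart; it determines s, because T is transitive, and then s and its
    orientation behaviour determine r. So an isomorphism class contains at most
    twice as many of the rotations as there are darts ([card_iso_class]), and
    2 ^ n <= 2 v ^ 2 N, where N is the number of classes. Since v <= 8n, this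
    implies the bound when n >= 8, and for n < 8 the bound is at most 1
    ([lower_bound_count]).

    The bound is 2 to the power n / 2 - log2 (9 n ^ 2), and n / 2 is v / (2a) up
    to a constant if v = a n + t with a and t fixed; the logarithm is o(v). *)

(** * Merging and splitting the cycles of a permutation *)

Section Merging.
Variable T : finType.
Implicit Types (s : {perm T}) (a b c x y z : T).

Lemma porbit_subset_stable s (U : {set T}) x :
  (forall y, y \in U -> s y \in U) -> x \in U -> porbit s x \subset U.
Proof.
move=> sU xU; apply/fintype.subsetP => y /porbitP[i ->].
elim: i => [|i IH]; first by rewrite expg0 perm1.
by rewrite expgSr permM; exact: sU.
Qed.

Lemma porbit_step s x y : (s y \in porbit s x) = (y \in porbit s x).
Proof. by rewrite -!eq_porbit_mem -(porbit_perm s 1 y) expg1. Qed.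

Lemma porbit_tperm_out s a b x :
  a \notin porbit s x -> b \notin porbit s x ->
  porbit (tperm a b * s)%g x = porbit s x.
Proof.
move=> ax bx; have E i : ((tperm a b * s) ^+ i)%g x = (s ^+ i)%g x.
  elim: i => [|i IH]; first by rewrite !expg0.
  rewrite !expgSr !permM IH tpermD //; apply: contraTneq (mem_porbit s i x) => <- //.
by apply/setP => y; apply/porbitP/porbitP => -[i ->]; exists i; rewrite E.
Qed.

Lemma porbit_tperm_merge s a b : a \notin porbit s b ->
  porbit (tperm a b * s)%g a = porbit s a :|: porbit s b.
Proof.
(* From u, the product runs through the whole old cycle of v, starting at the
   image of v; the lemma follows by exchanging the two points. *)
have half s' u v : u \notin porbit s' v ->
    porbit s' v \subset porbit (tperm u v * s')%g u.
  move=> uv; have Q i : (s' ^+ i.+1)%g v \in porbit (tperm u v * s')%g u.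
    elim: i => [|i IH].
      by rewrite expg1 -[v in s' v](tpermL u v) -permM porbit_step porbit_id.
    rewrite expgSr permM.
    have [->|nv] := eqVneq ((s' ^+ i.+1)%g v) v.
      by rewrite -[v in s' v](tpermL u v) -permM porbit_step porbit_id.
    have nu : u != (s' ^+ i.+1)%g v.
      by apply: contraNneq uv => ->; exact: mem_porbit.
    by rewrite -[X in s' X](tpermD nu (_ : v != _)) 1?eq_sym // -permM porbit_step.
  apply/fintype.subsetP => y /porbitP[[|i] ->]; last exact: Q.
  rewrite expg0 perm1 -porbit_step permM.
  have := iter_porbit s' v; case E: #|porbit s' v| => [|k].
    by move/eqP: E; rewrite (negPf (card_porbit_neq0 _ _)).
  rewrite iterS -permX => sv.
  have := Q k; rewrite expgSr permM sv -porbit_step permM => //.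
move=> ab; apply/eqP; rewrite finset.eqEsubset; apply/andP; split.
  apply: porbit_subset_stable; last by rewrite inE porbit_id.
  move=> y; rewrite !inE permM; case: tpermP => [->|->|_ _].
  - by rewrite !porbit_step => _; rewrite porbit_id orbT.
  - by rewrite !porbit_step => _; rewrite porbit_id.
  by rewrite !porbit_step.
have B := half _ _ _ ab.
have ba : b \notin porbit s a by rewrite porbit_sym.
have A := half _ _ _ ba; rewrite tpermC in A.
have bA : b \in porbit (tperm a b * s)%g a.
  by apply: (fintype.subsetP B); exact: porbit_id.
move: bA; rewrite -eq_porbit_mem => /eqP bA.
by rewrite finset.subUset B -bA A.
Qed.

Lemma porbit_merge3 s a b c :
  a \notin porbit s b -> a \notin porbit s c -> b \notin porbit s c ->
  porbit (tperm a c * (tperm a b * s))%g a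
    = porbit s a :|: porbit s b :|: porbit s c.
Proof.
move=> ab ac bc.
have C : porbit (tperm a b * s)%g c = porbit s c by exact: porbit_tperm_out.
by rewrite porbit_tperm_merge ?C // porbit_tperm_merge.
Qed.

Lemma transitive_card s (x0 : T) :
  (forall x y, y \in porbit s x) -> #|porbits s| = 1.
Proof.
move=> H; apply/eqP/cards1P; exists (porbit s x0).
apply/setP => U; rewrite inE; apply/imsetP/eqP => [[x _ ->]|->].
  by apply/eqP; rewrite eq_porbit_mem.
by exists x0.
Qed.

Lemma card_transitive s : #|porbits s| = 1 -> forall x y, y \in porbit s x.
Proof.
move/eqP/cards1P => [U HU] x y.
have M z : porbit s z = U by apply/set1P; rewrite -HU; exact: imset_f.
by rewrite M -(M y) porbit_id.
Qed.

(** The two products of transpositions are the two 3-cycles on [a], [b], [c]: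
    [tperm a b] splits the single cycle into a part containing [a] and a part
    containing [b], and the second transposition merges them again if it joins
    [c] to the one of [a] and [b] that lies in the other part. *)
Lemma transitive_neutral s a b c :
  a != b -> a != c -> b != c -> (forall x y, y \in porbit s x) ->
  (forall x y, y \in porbit (tperm a c * (tperm a b * s))%g x) \/
  (forall x y, y \in porbit (tperm b c * (tperm a b * s))%g x).
Proof.
move=> ab ac bc tr; set s' := (tperm a b * s)%g.
have c1 := transitive_card a tr.
have c2 : #|porbits s'| = 2.
  by have := porbits_mul_tperm s a b; rewrite /= tr ab c1 /= -/s'; lia.
have nab : a \notin porbit s' b.
  have := porbits_mul_tperm s' a b; rewrite /= c2 ab /s' mulgA tperm2 mul1g c1.
  by case: (_ \notin _).
have [ca|ca] := boolP (a \in porbit s' c); [right|left]; apply: card_transitive.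
  have nbc : b \notin porbit s' c.
    apply: contra nab => h; rewrite -eq_porbit_mem in h; rewrite (eqP h); exact: ca.
  by have := porbits_mul_tperm s' b c; rewrite /= nbc c2 bc /=; lia.
by have := porbits_mul_tperm s' a c; rewrite /= ca c2 ac /=; lia.
Qed.

End Merging.

(** * Orienting the rows and columns of a cyclic 3-diagonal array *)

Lemma ord_eqE n (i j : 'I_n) : (i == j) = (nat_of_ord i == nat_of_ord j).
Proof. by []. Qed.

Lemma odd_ltS k i : odd k -> k != (2 * i + 1)%N -> (k < 2 * i.+1)%N = (k < 2 * i)%N.
Proof. by move=> ok ki; have := modn2 k; rewrite ok /= => H; apply/idP/idP; lia. Qed.

Section Turns.
Variable p : nat.
Local Notation cell := ('I_p.+1 * 'Z_3)%type.
Local Open Scope ring_scope.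

(** A cell is a column together with a position in that column; [turn d] shifts
    the cells of column [j] cyclically by [d j], so it orients every column in
    which [d j] is nonzero and fixes the other columns pointwise. *)
Definition turn_fun (d : 'I_p.+1 -> 'Z_3) (x : cell) : cell := (x.1, x.2 + d x.1).

Lemma turn_inj d : injective (turn_fun d).
Proof.
apply: (can_inj (g := turn_fun (fun j => - d j))) => -[j q].
by rewrite /turn_fun /= addrK.
Qed.

Definition turn d : {perm cell} := perm (@turn_inj d).

Lemma turnE d x : turn d x = (x.1, x.2 + d x.1).
Proof. by rewrite permE. Qed.

Lemma turnM d d' : (turn d * turn d')%g = turn (fun j => d j + d' j).
Proof. by apply/permP => x; rewrite permM !turnE /= addrA. Qed.

Lemma turnX d i x : (turn d ^+ i)%g x = (x.1, x.2 + d x.1 *+ i).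
Proof.
elim: i => [|i IH]; first by rewrite expg0 perm1 mulr0n addr0; case: x.
by rewrite expgSr permM IH turnE /= -addrA -mulrSr.
Qed.

Lemma porbit_turn d x y : d x.1 != 0 -> (y \in porbit (turn d) x) = (y.1 == x.1).
Proof.
move=> dx; apply/porbitP/eqP => [[i ->]|yx]; first by rewrite turnX.
case: x y dx yx => j q [j' q'] /= dx ->.
have dd : d j * d j = 1.
  by move: (d j) dx => [[|[|[|//]]] ?] // _; apply: val_inj.
have T : q' = q + d j *+ nat_of_ord (d j * (q' - q)).
  by rewrite -mulr_natr natr_Zp mulrA dd mul1r addrC subrK.
by exists (nat_of_ord (d j * (q' - q))); rewrite turnX {1}T.
Qed.

(** The cell in position [q] of column [j]. *)
Definition cl (j : 'I_p.+1) (q : nat) : 'I_p.+1 * 'Z_3 := (j, inZp q).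

(** The 3-cycle on column [j] alone. *)
Definition turn1 (j : 'I_p.+1) (e : 'Z_3) := turn (fun i => if i == j then e else 0).

Lemma turn1_2 j :
  turn1 j 2%:R = (tperm (cl j 0) (cl j 2) * tperm (cl j 0) (cl j 1))%g.
Proof.
apply/permP => -[i q]; rewrite permM turnE /=.
case: eqP => [->|ij]; last first.
  by rewrite addr0 !tpermD //; apply/eqP => -[] /esym.
case: q => [[|[|[|//]]] ?]; rewrite /cl /tperm !permE /= -!pair_eqE /= !eqxx /=;
  by congr pair; apply: val_inj.
Qed.

Lemma turn1_1 j :
  turn1 j 1 = (tperm (cl j 1) (cl j 2) * tperm (cl j 0) (cl j 1))%g.
Proof.
apply/permP => -[i q]; rewrite permM turnE /=.
case: eqP => [->|ij]; last first.
  by rewrite addr0 !tpermD //; apply/eqP => -[] /esym.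
case: q => [[|[|[|//]]] ?]; rewrite /cl /tperm !permE /= -!pair_eqE /= !eqxx /=;
  by congr pair; apply: val_inj.
Qed.

(** Positions 0, 1 and 2 of column [j] lie in the rows [j - 1], [j + 1] and [j]:
    row [i] consists of the cells [(i + 1, 0)], [(i - 1, 1)] and [(i, 2)]. *)
Definition off (q : 'Z_3) : 'I_p.+1 :=
  if val q == 0%N then - inZp 1 else if val q == 1%N then inZp 1 else 0.
Definition cell_row (x : cell) : 'I_p.+1 := x.1 + off x.2.

(** Replaces the column coordinate of a cell by its row. *)
Definition to_row_fun (x : cell) : cell := (cell_row x, x.2).
Lemma to_row_inj : injective to_row_fun.
Proof.
apply: (can_inj (g := fun x => (x.1 - off x.2, x.2))) => -[j q].
by rewrite /cell_row /= addrK.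
Qed.
Definition to_row : {perm cell} := perm to_row_inj.
Lemma to_rowE x : to_row x = (cell_row x, x.2).
Proof. by rewrite permE. Qed.

(** The analogue of [turn] for the rows. *)
Definition row_turn (d : 'I_p.+1 -> 'Z_3) : {perm cell} := (turn d ^ to_row^-1)%g.

Lemma row_turn_row d x : to_row (row_turn d x) = (cell_row x, x.2 + d (cell_row x)).
Proof.
by rewrite /row_turn conjgE invgK !permM permKV turnE to_rowE.
Qed.

Lemma porbit_row_turn d x y : d (cell_row x) != 0 ->
  (y \in porbit (row_turn d) x) = (cell_row y == cell_row x).
Proof.
move=> dx.
have -> : (y \in porbit (row_turn d) x) = (to_row y \in porbit (turn d) (to_row x)).
  apply/porbitP/porbitP => -[i E]; exists i.
    by rewrite E /row_turn -conjXg conjgE invgK !permM permKV.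
  apply: (@perm_inj _ to_row).
  by rewrite E /row_turn -conjXg conjgE invgK !permM permKV.
by rewrite porbit_turn !to_rowE.
Qed.

End Turns.

Section Unicellular.
Variable m : nat.
Local Notation p := (2 * m)%N.
Local Notation cell := ('I_p.+1 * 'Z_3)%type.
Local Open Scope ring_scope.

Variable eps : 'I_p.+1 -> 'Z_3.
Hypothesis eps0 : forall i, eps i != 0.

(** The orientation of the first [i] columns of odd index, the other columns
    being left out. *)
Definition odd_cols (i : nat) (j : 'I_p.+1) : 'Z_3 :=
  if odd j && (j < 2 * i)%N then 2%:R else 0.

Lemma row_col i (j : 'I_p.+1) : (i < m)%N -> nat_of_ord j = (2 * i + 1)%N ->
  [/\ nat_of_ord (cell_row (cl j 0)) = (2 * i)%N,
      nat_of_ord (cell_row (cl j 1)) = (2 * i + 2)%N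
    & nat_of_ord (cell_row (cl j 2)) = (2 * i + 1)%N].
Proof.
move=> im jE; split; rewrite /cell_row /off /=.
- have -> : (1 %% p.+1 = 1)%N by rewrite modn_small; lia.
  have -> : ((p.+1 - 1) %% p.+1 = p)%N by rewrite modn_small; lia.
  rewrite jE (_ : 2 * i + 1 + p = 2 * i + p.+1)%N; last lia.
  by rewrite modnDr modn_small; lia.
- by rewrite modnDmr jE modn_small; lia.
by rewrite jE modn_small; lia.
Qed.

(** Column [2 i + 1] merges the rows [2 i + 1] and [2 i + 2] into the cycle formed
    by the rows up to [2 i]. *)
Lemma odd_cols_porbit i x : (i <= m)%N ->
  porbit (turn (odd_cols i) * row_turn eps)%g x =
    [set y | if (cell_row x <= 2 * i)%N then (cell_row y <= 2 * i)%N
             else cell_row y == cell_row x].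
Proof.
elim: i x => [|i IH] x im.
  have -> : turn (odd_cols 0) = 1%g.
    apply/permP => y; rewrite turnE perm1 /odd_cols muln0 ltn0 andbF addr0.
    by case: y.
  rewrite mul1g; apply/setP => y; rewrite porbit_row_turn // inE muln0 !leqn0.
  by have [x0|//] := eqVneq (nat_of_ord (cell_row x)) 0%N; rewrite ord_eqE x0.
have {}IH := IH^~ (ltnW im).
pose j : 'I_p.+1 := inord (2 * i + 1).
have jE : nat_of_ord j = (2 * i + 1)%N by rewrite /= inordK //; lia.
have [ra rb rc] := row_col im jE.
set s := (turn (odd_cols i) * row_turn eps)%g in IH.
have -> : (turn (odd_cols i.+1) * row_turn eps)%g =
    (tperm (cl j 0) (cl j 2) * (tperm (cl j 0) (cl j 1) * s))%g.
  rewrite [RHS]mulgA -turn1_2 /s [RHS]mulgA; congr (_ * _)%g.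
  rewrite /turn1 turnM; apply/permP => y; rewrite !turnE; congr (_, _ + _).
  rewrite /odd_cols ord_eqE jE.
  have [->|ne] := eqVneq (nat_of_ord y.1) (2 * i + 1)%N.
    have -> : odd (2 * i + 1) by rewrite oddD oddM.
    have -> : (2 * i + 1 < 2 * i.+1)%N by lia.
    have -> : (2 * i + 1 < 2 * i)%N = false by lia.
    by rewrite addr0.
  rewrite add0r; congr (if _ then _ else _); case: (boolP (odd _)) => //= oy.
  exact: odd_ltS.
have OUT y z : (z \in porbit s y) =
    if (cell_row y <= 2 * i)%N then (cell_row z <= 2 * i)%N
    else cell_row z == cell_row y.
  by rewrite IH inE.
have M : porbit (tperm (cl j 0) (cl j 2) * (tperm (cl j 0) (cl j 1) * s))%g (cl j 0)
   = [set y | (cell_row y <= 2 * i.+1)%N].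
  rewrite porbit_merge3; last 3 first.
  - by rewrite OUT ord_eqE ra rb ifN; lia.
  - by rewrite OUT ord_eqE ra rc ifN; lia.
  - by rewrite OUT ord_eqE rb rc ifN; lia.
  apply/setP => y; rewrite !inE !OUT !ord_eqE ra rb rc leqnn !ifN; lia.
have [xU|xU] := leqP (cell_row x) (2 * i.+1).
  by rewrite -M; apply/eqP; rewrite eq_porbit_mem M inE.
have xn : (cell_row x <= 2 * i)%N = false by lia.
have o1 a : (cell_row a <= 2 * i.+1)%N -> a \notin porbit s x.
  by rewrite OUT xn ord_eqE; lia.
have t1 : porbit (tperm (cl j 0) (cl j 1) * s)%g x = porbit s x.
  by apply: porbit_tperm_out; apply: o1; rewrite ?ra ?rb; lia.
rewrite porbit_tperm_out ?t1; last 2 first.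
- by apply: o1; rewrite ra; lia.
- by apply: o1; rewrite rc; lia.
by apply/setP => y; rewrite OUT inE xn.
Qed.

(** Every orientation of the rows has a companion orientation of the columns. *)
Lemma unicellular : exists d : 'I_p.+1 -> 'Z_3, (forall j, d j != 0) /\
  forall x y, y \in porbit (turn d * row_turn eps)%g x.
Proof.
suff [d [d0 tr]] : exists d : 'I_p.+1 -> 'Z_3,
    (forall j, j \in enum 'I_p.+1 -> d j != 0) /\
    forall x y, y \in porbit (turn d * row_turn eps)%g x.
  by exists d; split=> // j; apply: d0; rewrite mem_enum.
(* After the odd columns, the remaining ones are inserted one at a time. *)
elim: (enum _) => [|j l [d [d0 tr]]].
  exists (odd_cols m); split=> // x y.
  by rewrite odd_cols_porbit // inE (_ : (cell_row x <= 2 * m)%N) -ltnS ltn_ord.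
have [dj|dj] := eqVneq (d j) 0; last first.
  by exists d; split=> // i; rewrite inE => /orP[/eqP->|/d0].
have ab : (cl j 0) != (cl j 1) by apply/eqP => -[].
have ac : (cl j 0) != (cl j 2) by apply/eqP => -[].
have bc : (cl j 1) != (cl j 2) by apply/eqP => -[].
have ext e : exists d', (forall i, d' i = if i == j then e else d i) /\
    (turn1 j e * (turn d * row_turn eps) = turn d' * row_turn eps)%g.
  exists (fun i => if i == j then e else d i); split=> //.
  rewrite mulgA /turn1 turnM; congr (_ * _)%g; apply/permP => y; rewrite !turnE.
  by congr (_, _ + _); case: eqP => [->|]; rewrite ?dj ?addr0 ?add0r.
have [] := transitive_neutral ab ac bc tr; rewrite mulgA -?turn1_2 -?turn1_1.
  have [d' [dE ->]] := ext 2%:R => tr'; exists d'; split=> // i.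
  by rewrite dE inE; case: eqP => //= _ /d0.
have [d' [dE ->]] := ext 1 => tr'; exists d'; split=> // i.
by rewrite dE inE; case: eqP => //= _ /d0.
Qed.

End Unicellular.

(** * Triangular rotations from two systems of zero-sum triples *)

Lemma dart_ext (G : sgraph) (d d' : dart G) :
  dtail d = dtail d' -> dhead d = dhead d' -> d = d'.
Proof.
case: d d' => [[x y] xy] [[x' y'] xy']; rewrite /dtail /dhead /= => xx yy.
by apply: val_inj; rewrite /= xx yy.
Qed.

(** The vertices of [G] are labelled by a finite abelian group [A], and [e] lists
    one element of each pair of opposite elements of the connection set. *)
Section Rotation.
Variables (A : finZmodType) (G : sgraph) (phi : G -> A) (psi : A -> G).
Hypotheses (phiK : cancel phi psi) (psiK : cancel psi phi).
Variables (I : finType) (e : I -> A).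
Local Open Scope ring_scope.

(** [e] and its opposite, the boolean standing for the sign. *)
Definition signed (ib : I * bool) : A := if ib.2 then - e ib.1 else e ib.1.

Hypothesis signed_inj : injective signed.
Hypothesis edgeE : forall x y : G, sedge x y = (phi y - phi x \in codom signed).

(** A permutation of order dividing 3 for which three successive images of an
    index have entries of sum zero. *)
Definition zero_sum_turn (w : {perm I}) : Prop :=
  forall i, w (w (w i)) = i /\ e i + e (w i) + e (w (w i)) = 0.

Section Def.
Variables wr wc : {perm I}.

(** The rotation around the vertex labelled 0: it sends [e i] to [- e (wr i)] and
    [- e i] to [e (wc i)], and is extended by the identity. *)
Definition rot0_fun (z : A) : A :=
  if [pick ib | signed ib == z] is Some ib then
    signed (if ib.2 then wc ib.1 else wr ib.1, ~~ ib.2) else z.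

Lemma rot0_signed i b :
  rot0_fun (signed (i, b)) = signed (if b then wc i else wr i, ~~ b).
Proof.
rewrite /rot0_fun; case: pickP => [ib /eqP/signed_inj ->//|/(_ (i, b))].
by rewrite eqxx.
Qed.

Lemma rot0_out z : z \notin codom signed -> rot0_fun z = z.
Proof.
rewrite /rot0_fun; case: pickP => // ib /eqP <-.
by rewrite codom_f.
Qed.

Lemma rot0_codom z : (rot0_fun z \in codom signed) = (z \in codom signed).
Proof.
have [/codomP[[i b] ->]|zS] := boolP (z \in codom signed).
  by rewrite rot0_signed codom_f.
by rewrite rot0_out // (negPf zS).
Qed.

Lemma rot0_inj : injective rot0_fun.
Proof.
move=> z z' E.
have [zS|zS] := boolP (z \in codom signed); last first.
  have z'S : z' \notin codom signed by rewrite -rot0_codom -E rot0_codom.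
  by rewrite -(rot0_out zS) E rot0_out.
have z'S : z' \in codom signed by rewrite -rot0_codom -E rot0_codom.
case/codomP: zS z'S E => [[i b] ->] /codomP[[i' b'] ->].
rewrite !rot0_signed => /signed_inj.
by case: b b' => [] [] // [] /perm_inj ->.
Qed.

Definition rot0 : {perm A} := perm rot0_inj.

Lemma rot0E i b :
  rot0 (signed (i, b)) = signed (if b then wc i else wr i, ~~ b).
Proof. by rewrite permE rot0_signed. Qed.

(** The rotation around [x], obtained by translation. *)
Definition vrot_fun (x y : G) : G := psi (phi x + rot0 (phi y - phi x)).

Lemma vrot_inj x : injective (vrot_fun x).
Proof.
move=> y y' /(can_inj psiK)/addrI/perm_inj/addIr; exact: (can_inj phiK).
Qed.

Definition vrot x : {perm G} := perm (@vrot_inj x).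

Lemma vrotE x y : phi (vrot x y) = phi x + rot0 (phi y - phi x).
Proof. by rewrite permE /vrot_fun psiK. Qed.

Lemma vrotX x y i : phi ((vrot x ^+ i)%g y) = phi x + (rot0 ^+ i)%g (phi y - phi x).
Proof.
elim: i => [|i IH]; first by rewrite !expg0 !perm1 addrC subrK.
rewrite !expgSr !permM vrotE IH; congr (_ + rot0 _).
by rewrite addrAC subrr add0r.
Qed.

Lemma vrot_edge x y : sedge x (vrot x y) = sedge x y.
Proof.
rewrite !edgeE vrotE addrAC subrr add0r permE.
exact: rot0_codom.
Qed.

(** The rotation on the darts. *)
Definition drot_fun (d : dart G) : dart G :=
  exist (fun d : G * G => sedge d.1 d.2) (dtail d, vrot (dtail d) (dhead d))
    (etrans (vrot_edge _ _) (svalP d)).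

Lemma drot_inj : injective drot_fun.
Proof.
move=> d d' /(congr1 sval) /pair_equal_spec[t h].
by apply: dart_ext => //; move: h; rewrite t => /perm_inj.
Qed.

Definition drot : {perm dart G} := perm drot_inj.

Lemma drotE d : sval (drot d) = (dtail d, vrot (dtail d) (dhead d)).
Proof. by rewrite permE. Qed.

Lemma drot_tail d : dtail (drot d) = dtail d.
Proof. by rewrite {1}/dtail drotE. Qed.

Lemma drot_head d : dhead (drot d) = vrot (dtail d) (dhead d).
Proof. by rewrite {1}/dhead drotE. Qed.

(** The colour of a dart: whether its difference is an [e i]. *)
Definition dcolor (d : dart G) : bool := phi (dhead d) - phi (dtail d) \in codom e.

Lemma signed_codom i b : (signed (i, b) \in codom e) = ~~ b.
Proof.
case: b; last by rewrite /signed /= codom_f.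
apply/codomP => -[j E].
by have /signed_inj := E : signed (i, true) = signed (j, false).
Qed.

Lemma dart_signed (d : dart G) :
  exists i b, phi (dhead d) - phi (dtail d) = signed (i, b).
Proof.
have := svalP d; rewrite edgeE => /codomP[[i b] E]; by exists i, b.
Qed.

(** The difference of a dart is changed by face tracing into the next element
    of the same triple. *)
Lemma face_step (d : dart G) i b : phi (dhead d) - phi (dtail d) = signed (i, b) ->
  let d' := face_tracing drot d in
  phi (dtail d') = phi (dtail d) + signed (i, b) /\
  phi (dhead d') - phi (dtail d') = signed (if b then wr i else wc i, b).
Proof.
move=> E /=; rewrite /face_tracing permM [drev_perm G d]permE.
rewrite drot_tail drot_head -[dtail (drev d)]/(dhead d).
rewrite -[dhead (drev d)]/(dtail d) -E addrC subrK; split=> //.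
rewrite vrotE addrAC subrr add0r permE.
rewrite -opprB E (_ : - _ = signed (i, ~~ b)) ?rot0_signed; first by case: b {E}.
by rewrite /signed /=; case: b {E} => /=; rewrite ?opprK.
Qed.

Lemma dcolor_face d : dcolor (face_tracing drot d) = dcolor d.
Proof.
have [i [b E]] := dart_signed d; have [_ E'] := face_step E.
by rewrite /dcolor E E' !signed_codom.
Qed.

Lemma dcolor_rev d : dcolor (drev d) = ~~ dcolor d.
Proof.
have [i [b E]] := dart_signed d.
rewrite /dcolor /dhead /dtail /= -opprB E.
rewrite (_ : - _ = signed (i, ~~ b)) ?signed_codom //.
by rewrite /signed /=; case: b {E} => /=; rewrite ?opprK.
Qed.

Lemma drot_biembedding : is_biembedding drot.
Proof.
exists (fun F : {set dart G} => [exists d in F, dcolor d]) => d.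
have C d' : [exists d0 in face_of drot d', dcolor d0] = dcolor d'.
  apply/exists_inP/idP => [[d0]|]; last by exists d' => //; exact: porbit_id.
  rewrite /face_of => /porbitP[i ->].
  elim: i => [|i IH]; first by rewrite expg0 perm1.
  by rewrite expgSr permM dcolor_face.
by rewrite !C dcolor_rev; case: dcolor.
Qed.

Hypotheses (zr : zero_sum_turn wr) (zc : zero_sum_turn wc).

Lemma signed_sum (b : bool) i (w := if b then wr else wc) :
  signed (i, b) + signed (w i, b) + signed (w (w i), b) = 0 /\ w (w (w i)) = i.
Proof.
rewrite /w /signed; case: b {w} => /=; last by case: (zc i).
by case: (zr i) => ? E; rewrite -!opprD E oppr0.
Qed.

Lemma signed_neq0 ib : signed ib != 0.
Proof.
apply/eqP => E; have : signed (ib.1, ~~ ib.2) = signed ib.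
  rewrite E; move: E; rewrite /signed /=.
  by case: ib.2 => /= /eqP; rewrite ?oppr_eq0 => /eqP ->; rewrite ?oppr0.
by move/signed_inj; case: ib {E} => i [].
Qed.

(** Three steps of face tracing lead back to [d], and the tails of the two darts
    met on the way differ from the tail of [d]. *)
Lemma face_of_drot d (f := face_tracing drot) :
  [/\ f (f (f d)) = d, dtail (f d) != dtail d & dtail (f (f d)) != dtail d].
Proof.
have [i [b E]] := dart_signed d; set w := if b then wr else wc.
have [t1 E1] := face_step E.
have {}E1 : phi (dhead (f d)) - phi (dtail (f d)) = signed (w i, b).
  by rewrite E1 /w; case: (b).
have [t2 E2] := face_step E1.
have {}E2 : phi (dhead (f (f d))) - phi (dtail (f (f d))) = signed (w (w i), b).
  by rewrite E2 /w; case: (b).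
have [t3 E3] := face_step E2.
have {}E3 : phi (dhead (f (f (f d)))) - phi (dtail (f (f (f d))))
    = signed (w (w (w i)), b).
  by rewrite E3 /w; case: (b).
have [s0 w3] : _ /\ _ := signed_sum b i; rewrite -/w in s0 w3.
rewrite -/f in t1 t2 t3; rewrite w3 -E in E3.
have T3 : phi (dtail (f (f (f d)))) = phi (dtail d).
  by rewrite t3 t2 t1 -!addrA [signed (i, b) + _]addrA s0 addr0.
split.
- apply: dart_ext; first exact: (can_inj phiK).
  by apply: (can_inj phiK); move: E3; rewrite T3 => /addIr.
- by rewrite -(can_eq phiK) t1 -subr_eq0 addrAC subrr add0r signed_neq0.
rewrite -(can_eq phiK) t2 t1 -addrA -subr_eq0 addrAC subrr add0r.
rewrite -[_ + _]opprK oppr_eq0 (_ : - _ = signed (w (w i), b)) ?signed_neq0 //.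
by apply/eqP; rewrite -subr_eq0 -opprD oppr_eq0 s0.
Qed.

Lemma drot_face F : F \in faces drot -> exists d (f := face_tracing drot),
  F = [set d; f d; f (f d)].
Proof.
case/imsetP => d _ ->; exists d => /=; set f := face_tracing drot.
have [f3 _ _] := face_of_drot d; rewrite -/f in f3.
apply/setP => x; rewrite !inE; apply/idP/idP.
  case/porbitP => i ->; elim: i => [|i]; first by rewrite expg0 perm1 eqxx.
  rewrite expgSr (permM (f ^+ i)%g f) => /orP[/orP[]|] /eqP ->; rewrite ?eqxx ?orbT //.
  by rewrite f3 eqxx.
case/orP => [/orP[]|] /eqP ->; first exact: porbit_id.
  by rewrite porbit_step porbit_id.
by rewrite !porbit_step porbit_id.
Qed.

Lemma drot_simple : is_simple drot.
Proof.
move=> F /drot_face[d ->]; set f := face_tracing drot.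
have [f3 n1 n2] := face_of_drot d; rewrite -/f in f3 n1 n2.
have [_ n3 _] := face_of_drot (f d); rewrite -/f in n3.
move=> x y; rewrite !inE => /orP[/orP[]|] /eqP -> /orP[/orP[]|] /eqP -> // /eqP.
- by rewrite eq_sym (negPf n1).
- by rewrite eq_sym (negPf n2).
- by rewrite (negPf n1).
- by rewrite eq_sym (negPf n3).
- by rewrite (negPf n2).
by rewrite (negPf n3).
Qed.

Lemma drot_3gonal : is_kgonal drot 3.
Proof.
move=> F /drot_face[d ->]; set f := face_tracing drot.
have [f3 n1 n2] := face_of_drot d; rewrite -/f in f3 n1 n2.
have [_ n3 _] := face_of_drot (f d); rewrite -/f in n3.
have ne (a b : dart G) : dtail b != dtail a -> a != b by apply: contraNneq => ->.
by rewrite -finset.setUA cardsU1 !inE negb_or !cards2 (ne _ _ n1) (ne _ _ n2) (ne _ _ n3).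
Qed.

Hypothesis one_cycle : forall i j, j \in porbit (wc * wr)%g i.

Lemma rot0_transitive y z : y \in codom signed -> z \in codom signed ->
  z \in porbit rot0 y.
Proof.
(* From - e i, two steps of the rotation around 0 lead to - e (wr (wc i)). *)
have two i k : (rot0 ^+ (2 * k))%g (signed (i, true))
    = signed (((wc * wr) ^+ k)%g i, true).
  elim: k => [|k IH]; first by rewrite muln0 !expg0 !perm1.
  by rewrite mulnS addnC expgD permM IH expgS expg1 permM !rot0E /= expgSr !permM.
have O i z' : z' \in codom signed -> z' \in porbit rot0 (signed (i, true)).
  case/codomP => -[j [] ->].
    have /porbitP[k ->] := one_cycle i j.
    by rewrite -two mem_porbit.
  have /porbitP[k E] := one_cycle i ((wc^-1)%g j).
  have := mem_porbit rot0 (2 * k).+1 (signed (i, true)).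
  by rewrite expgSr permM two -E rot0E /= permKV.
move=> yS zS; case: (pickP (fun i : I => true)) => [i _|I0].
  have P z' : z' \in codom signed -> porbit rot0 z' = porbit rot0 (signed (i, true)).
    by move=> z'S; apply/eqP; rewrite eq_porbit_mem O.
  by rewrite -eq_porbit_mem !P.
by case/codomP: yS => -[i b]; have := I0 i.
Qed.

Lemma drot_embedding : sconnected G -> is_embedding drot.
Proof.
move=> conn; split=> // x; exists (vrot x); split.
- apply/fintype.subsetP => y; rewrite !inE edgeE; apply: contraR => yS.
  rewrite -(can_eq phiK) vrotE permE.
  by rewrite rot0_out // addrC subrK.
- move=> y; rewrite inE => xy; apply/setP => z; rewrite inE.
  apply/porbitP/idP => [[i ->]|xz].
    by elim: i => [|i IH]; rewrite ?expg0 ?perm1 // expgSr permM vrot_edge.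
  have /porbitP[i E] : phi z - phi x \in porbit rot0 (phi y - phi x).
    by apply: rot0_transitive; rewrite -edgeE.
  exists i; apply: (can_inj phiK).
  by rewrite vrotX -E addrC subrK.
by move=> d <-; rewrite drotE.
Qed.

Lemma drot_biembedding3 : sconnected G -> simple_3gonal_biembedding drot.
Proof.
by move=> conn; split; [exact: drot_embedding | exact: drot_simple
  | exact: drot_3gonal | exact: drot_biembedding].
Qed.

End Def.

End Rotation.

(** * Counting isomorphism classes of rotations invariant under a translation *)

Section GisoTools.
Variables (G H K : sgraph).

Definition giso_comp (s : giso G H) (s' : giso H K) : giso G K :=
  GIso (bij_comp (giso_bij s') (giso_bij s))
    (fun x y => etrans (giso_edge s' (s x) (s y)) (giso_edge s x y)).

Lemma giso_dart_comp s s' d :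
  giso_dart (giso_comp s s') d = giso_dart s' (giso_dart s d).
Proof. exact: val_inj. Qed.

Lemma giso_dart_surj (s : giso G H) d' : exists d, giso_dart s d = d'.
Proof.
case: (giso_bij s) => g sK gK.
have xy : sedge (g (dtail d'), g (dhead d')).1 (g (dtail d'), g (dhead d')).2.
  by rewrite /= -(giso_edge s) !gK; exact: svalP d'.
exists (exist (fun d : G * G => sedge d.1 d.2) _ xy).
by apply: dart_ext; rewrite /dtail /dhead /= ?gK.
Qed.

Lemma giso_dart_rev (s : giso G H) d : giso_dart s (drev d) = drev (giso_dart s d).
Proof. exact: val_inj. Qed.

End GisoTools.

(** In an embedding, rotating and reversing reach every dart from any other. *)
Lemma dart_closure (G : sgraph) (rho : {perm dart G}) (P : dart G -> Prop) d0 :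
  is_embedding rho -> P d0 ->
  (forall d, P d -> P (rho d)) -> (forall d, P d -> P (drev d)) ->
  forall d, P d.
Proof.
case=> conn loc Pd0 Prho Prev.
have around d d' : dtail d = dtail d' -> P d -> P d'.
  move=> t Pd; have [rx [_ orb rE]] := loc (dtail d).
  have hd : dhead d \in nbhd (dtail d) by rewrite inE; exact: svalP d.
  have : dhead d' \in porbit rx (dhead d).
    by rewrite orb // inE t; exact: svalP d'.
  case/porbitP => i E.
  suff [Pi ti hi] : [/\ P ((rho ^+ i)%g d), dtail ((rho ^+ i)%g d) = dtail d
      & dhead ((rho ^+ i)%g d) = (rx ^+ i)%g (dhead d)].
    by rewrite -(_ : (rho ^+ i)%g d = d') //; apply: dart_ext; rewrite ?ti ?hi.
  elim: i {E} => [|i [Pi ti hi]]; first by rewrite !expg0 !perm1.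
  have := rE _ ti; rewrite !expgSr !permM => E.
  split; [exact: Prho | exact: (congr1 fst E) |].
  by rewrite -hi; exact: (congr1 snd E).
have step x y (xy : connect (@sedge G) x y) :
    (forall d, dtail d = x -> P d) -> (forall d, dtail d = y -> P d).
  case/connectP: xy => q; elim: q x => [|z q IH] x /=; first by move=> _ ->.
  case/andP => xz pq yq Px; apply: (IH z pq yq) => d dz.
  have := Px (exist (fun d : G * G => sedge d.1 d.2) (x, z) xz) erefl.
  by move/Prev; apply: around.
move=> d; apply: (step _ _ (conn (dtail d0) (dtail d))) => // d' d'E.
exact: around Pd0.
Qed.

Section IsoClasses.
Variables (G : sgraph) (T : giso G G) (d0 : dart G).
Hypothesis Ttrans : forall x y : G, exists k, y = iter k T x.

(** [T] is an automorphism of [r] preserving the orientation. *)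
Definition invariant_under (r : {perm dart G}) : Prop :=
  forall d, giso_dart T (r d) = r (giso_dart T d).

(** [s] maps the rotation [r] to [r'], up to reversing the orientation when
    [b] holds. *)
Definition maps_to (b : bool) (s : giso G G) (r r' : {perm dart G}) : Prop :=
  forall d, giso_dart s (r d) = (if b then r'^-1 else r')%g (giso_dart s d).

Lemma invariant_inv (b : bool) r : invariant_under r ->
  forall d, giso_dart T ((if b then r^-1 else r)%g d)
            = (if b then r^-1 else r)%g (giso_dart T d).
Proof.
move=> inv d; case: b => //; apply: (@perm_inj _ r).
by rewrite permKV -inv permKV.
Qed.

(** An isomorphism [s] from [r0] to [r] fixing the base vertex yields as key its
    orientation behaviour and the image of [d0] under the conjugate of [T] by
    [s], characterised by the last equation. *)
Definition iso_key (r0 r : {perm dart G}) (k : bool * dart G) : Prop :=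
  exists s : giso G G, [/\ s (dtail d0) = dtail d0, maps_to k.1 s r0 r
    & giso_dart s k.2 = giso_dart T (giso_dart s d0)].

Lemma iso_key_exists r0 r : invariant_under r -> emb_iso r0 r ->
  exists k, iso_key r0 r k.
Proof.
move=> inv [s0 s0E].
(* An iterated translation brings the image of the base vertex back to it. *)
have [b {s0E} s0b] : exists b, maps_to b s0 r0 r.
  by case: s0E => s0E; [exists false | exists true].
have [k kE] := Ttrans (s0 (dtail d0)) (dtail d0).
have [s [sE sb]] : exists s : giso G G,
    (forall x, s x = iter k T (s0 x)) /\ maps_to b s r0 r.
  elim: k {kE} => [|k [s [sE sb]]]; first by exists s0.
  exists (giso_comp s T); split=> [x|d]; first by rewrite /= sE.
  by rewrite !giso_dart_comp sb invariant_inv.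
have [d dE] := giso_dart_surj s (giso_dart T (giso_dart s d0)).
by exists (b, d); exists s; rewrite sE -kE.
Qed.

Lemma iso_key_inj r0 r1 r2 k : is_embedding r0 ->
  invariant_under r1 -> invariant_under r2 ->
  iso_key r0 r1 k -> iso_key r0 r2 k -> r1 = r2.
Proof.
case: k => b d emb i1 i2 [s1 [/= x1 m1 k1]] [s2 [/= x2 m2 k2]].
(* The conjugates of T by s1 and s2 agree on d0, hence everywhere. *)
have conj d' : exists e, giso_dart s1 e = giso_dart T (giso_dart s1 d') /\
    giso_dart s2 e = giso_dart T (giso_dart s2 d').
  move: d'; apply: (dart_closure emb (d0 := d0)); first by exists d.
    move=> d' [e [e1 e2]]; exists (r0 e).
    by rewrite m1 m2 e1 e2 m1 m2 !invariant_inv.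
  move=> d' [e [e1 e2]]; exists (drev e).
  by rewrite !giso_dart_rev e1 e2.
have vconj x : exists y, s1 y = T (s1 x) /\ s2 y = T (s2 x).
  have [j ->] := Ttrans (dtail d0) x.
  have -> : iter j T (dtail d0) = dtail (iter j (giso_dart T) d0).
    by elim: j => //= j ->.
  have [e [e1 e2]] := conj (iter j (giso_dart T) d0); exists (dtail e).
  by split; [exact: (congr1 (@dtail G) e1) | exact: (congr1 (@dtail G) e2)].
(* Every vertex is an iterated translate of the base vertex, so s1 = s2. *)
have com z : exists y, s1 y = z /\ s2 y = z.
  have [j ->] := Ttrans (dtail d0) z; elim: j => [|j [y [y1 y2]]].
    by exists (dtail d0).
  have [y' [y'1 y'2]] := vconj y; exists y'.
  by rewrite y'1 y'2 y1 y2.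
have s12 x : s1 x = s2 x.
  have [y [y1 y2]] := com (s1 x).
  by rewrite -{1}y2 (bij_inj (giso_bij s1) y1).
have d12 e : giso_dart s1 e = giso_dart s2 e by apply: dart_ext; exact: s12.
suff E : (if b then r1^-1 else r1)%g = (if b then r2^-1 else r2)%g.
  by case: b E {m1 m2} => // /invg_inj.
apply/permP => e; have [e' <-] := giso_dart_surj s1 e.
by rewrite -m1 d12 m2 -d12.
Qed.

Lemma card_iso_class (r0 : {perm dart G}) (F : {set {perm dart G}}) :
  is_embedding r0 ->
  (forall r, r \in F -> invariant_under r /\ emb_iso r0 r) ->
  #|F| <= 2 * #|{: dart G}|.
Proof.
move=> emb FP.
pose key r := if pselect (exists k, iso_key r0 r k) is left h then sval (cid h)
  else (true, d0).
have keyP r : r \in F -> iso_key r0 r (key r).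
  move=> /FP[inv iso]; rewrite /key.
  case: pselect => [h|[]]; first exact: svalP (cid h).
  exact: iso_key_exists.
have <- : #|key @: F| = #|F|.
  apply: card_in_imset => r1 r2 r1F r2F E.
  apply: (iso_key_inj emb (FP _ r1F).1 (FP _ r2F).1 (keyP _ r1F)).
  by rewrite E; exact: keyP.
by rewrite (leq_trans (max_card _)) // card_prod card_bool.
Qed.

Lemma leq_nb_iso_classes (P : {perm dart G} -> Prop) (F : {set {perm dart G}}) :
  (forall r, P r -> is_embedding r) ->
  (forall r, r \in F -> invariant_under r /\ P r) ->
  #|F| <= nb_iso_classes P * (2 * #|{: dart G}|).
Proof.
move=> Pemb FP; rewrite /nb_iso_classes.
set D := [set rho | `[< P rho >]]%SET; set E := equivalence_partition _ _.
have FD r : r \in F -> r \in D by move=> /FP[_ Pr]; rewrite inE; apply/asboolP.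
have sub : F \subset finset.cover [set F :&: C | C in E]%SET.
  apply/fintype.subsetP => r rF; apply/finset.bigcupP.
  exists (F :&: [set y in D | iso_relb r y])%SET.
    by apply: imset_f; apply: imset_f; exact: FD.
  rewrite !inE rF; move: (FD r rF); rewrite inE => -> /=.
  by apply/asboolP; exact: emb_iso_refl.
apply: leq_trans (subset_leq_card sub) _.
apply: leq_trans (finset.leq_card_cover _) _.
apply: (@leq_trans (\sum_(B in [set F :&: C | C in E]%SET) 2 * #|{: dart G}|)).
  apply: leq_sum => _ /imsetP[_ /imsetP[r0 r0D ->] ->].
  apply: (@card_iso_class r0).
    by apply: Pemb; move: r0D; rewrite inE => /asboolP.
  move=> r; rewrite !inE => /andP[/FP[inv _] /andP[_ /asboolP iso]].
  by split.
by rewrite sum_nat_const leq_mul2r leq_imset_card orbT.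
Qed.

End IsoClasses.

(** * The zero-sum triples of an array *)

Lemma sum3_perms (A : zmodType) (x y z : A) : (x + y + z = 0 ->
  [/\ x + z + y = 0, y + x + z = 0, y + z + x = 0, z + x + y = 0
    & z + y + x = 0])%R.
Proof.
move=> s; split; rewrite -s.
- by rewrite addrAC.
- by rewrite (addrC y).
- by rewrite addrC addrA.
- by rewrite -addrA addrC.
by rewrite addrC (addrC z) addrA.
Qed.

Section Triples.
Variables (A : finZmodType) (p : nat) (b : 'I_p.+1 -> A) (K : A).
Local Notation cell := ('I_p.+1 * 'Z_3)%type.
Local Open Scope ring_scope.

(** The array determined by the cyclic sequence [b] and the constant [K]: column
    [j] consists of [b (j - 1)], [b j + K] and [- (b (j - 1) + b j + K)]. As
    [off p 0] is -1, [x.1 + off p 0] is the preceding column. *)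
Definition entry (x : cell) : A :=
  let b0 := b (x.1 + off p 0) in
  if val x.2 == 0%N then b0
  else if val x.2 == 1%N then b x.1 + K else - (b0 + b x.1 + K).

Lemma Z3_sum (f : 'Z_3 -> A) q d : d != 0 -> f 0 + f 1 + f (1 + 1) = 0 ->
  f q + f (q + d) + f (q + d + d) = 0.
Proof.
move=> d0 f0; pose z (k : nat) := f (inZp k).
have fE x : f x = z (val x) by rewrite /z; congr f; rewrite valZpK.
have {}f0 : z 0%N + z 1%N + z 2%N = 0 by move: f0; rewrite !fE.
have [s1 s2 s3 s4 s5] := sum3_perms f0.
rewrite !fE; case: q d d0 => [[|[|[|//]]] ?] [[|[|[|//]]] ?] //= _;
  by rewrite /modn /= ?f0 ?s1 ?s2 ?s3 ?s4 ?s5.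
Qed.

Lemma Z3_triple (q d : 'Z_3) : q + d + d + d = q.
Proof. by case: q d => [[|[|[|//]]] ?] [[|[|[|//]]] ?]; apply: val_inj. Qed.

Lemma zero_sum_turn_turn d : (forall j, d j != 0) -> zero_sum_turn entry (turn d).
Proof.
move=> d0 [j q]; rewrite !turnE /= Z3_triple; split=> //.
apply: (Z3_sum (f := fun q => entry (j, q)) _ (d0 j)).
by rewrite /entry /= addrA subrr.
Qed.

Lemma to_row_cell r q : to_row p (r - off p q, q) = (r, q).
Proof. by rewrite to_rowE; congr (_, _); exact: subrK. Qed.

Lemma zero_sum_turn_row d : (forall j, d j != 0) -> zero_sum_turn entry (row_turn d).
Proof.
move=> d0 x; pose c q := (cell_row x - off p q, q).
have cE y q : cell_row y = cell_row x -> y.2 = q -> y = c q.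
  move=> ry yq; apply: (@perm_inj _ (to_row p)).
  by rewrite /c to_row_cell to_rowE ry yq.
have wE q : row_turn d (c q) = c (q + d (cell_row x)).
  have rc : cell_row (c q) = cell_row x by exact: subrK.
  apply: (@perm_inj _ (to_row p)).
  by rewrite row_turn_row rc /c to_row_cell.
rewrite (cE x x.2) // !wE Z3_triple; split=> //.
apply: (Z3_sum (f := fun q => entry (c q)) _ (d0 _)).
set r := cell_row x in c cE wE *.
have -> : entry (c 0) = b (r - off p 0 + off p 0) by [].
rewrite subrK.
have -> : entry (c 1) = b (r + off p 0) + K by [].
have -> : entry (c (1 + 1)) = - (b (r - 0 + off p 0) + b (r - 0) + K) by [].
by rewrite subr0 addrA (addrC (b r)) subrr.
Qed.

End Triples.

(** * Rotations of complete multipartite graphs *)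

Section CompleteMultipartite.
Variables m t : nat.
Hypotheses (m1 : (1 < m)%N) (t0 : (0 < t)%N).
Local Notation v := (m * t)%N.
Local Notation G := (complete_multipartite m t).
Local Open Scope ring_scope.

Let v1 : (1 < v)%N. Proof. by rewrite (leq_trans m1) // leq_pmulr. Qed.

(** Labelling of the vertices by Z_v in which the parts are the classes modulo
    [m]. *)
Definition vlabel (x : G) : 'Z_v := (x.1 + m * x.2)%:R.

Lemma val_vlabel x : nat_of_ord (vlabel x) = (x.1 + m * x.2)%N.
Proof.
rewrite val_Zp_nat // modn_small //.
by have := ltn_ord x.1; have := ltn_ord x.2; nia.
Qed.

Lemma vlabel_mod x : (vlabel x %% m)%N = x.1.
Proof. by rewrite val_vlabel mulnC addnC modnMDl modn_small. Qed.

Lemma vlabel_bij : bijective vlabel.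
Proof.
apply: inj_card_bij; last by rewrite !card_ord card_prod !card_ord Zp_cast.
move=> x y E; have E1 : x.1 = y.1 by apply: val_inj; rewrite /= -!vlabel_mod E.
have := val_vlabel x; rewrite E val_vlabel E1 => /eqP.
rewrite eqn_add2l eqn_pmul2l 1?(ltn_trans _ m1) // => /eqP /val_inj E2.
by rewrite [x]surjective_pairing [y]surjective_pairing E1 E2.
Qed.

Lemma Zadd_mod (x y : 'Z_v) : (nat_of_ord (x + y)%R %% m)%N = ((x + y)%N %% m)%N.
Proof. by rewrite /= modn_dvdm // Zp_cast // dvdn_mulr. Qed.

Lemma dvdn_Zopp (x : 'Z_v) : (m %| (- x)%R)%N = (m %| x)%N.
Proof.
have H (y : 'Z_v) : (m %| y)%N -> (m %| (- y)%R)%N.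
  move=> my; have := Zadd_mod (- y) y; rewrite addNr /= mod0n => /esym/eqP E.
  by rewrite -(dvdn_addl _ my).
by apply/idP/idP => [/H|/H //]; rewrite opprK.
Qed.

Lemma edge_vlabel (x y : G) : sedge x y = ~~ (m %| (vlabel y - vlabel x)%R)%N.
Proof.
have E : vlabel y = vlabel y - vlabel x + vlabel x by rewrite subrK.
have : nat_of_ord (vlabel y) = ((vlabel y - vlabel x)%R + vlabel x)%N %[mod m].
  by rewrite {1}E Zadd_mod.
rewrite -modnDmr !vlabel_mod => H.
rewrite /sedge /= -val_eqE /= eq_sym; congr (~~ _).
set d := nat_of_ord (vlabel y - vlabel x) in H *.
have -> : (nat_of_ord y.1 == x.1) = (d + x.1 == 0 + x.1 %[mod m])%N.
  by rewrite add0n -H !modn_small.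
by rewrite eqn_modDr mod0n.
Qed.

Lemma card_unmultiple : #|[set z : 'Z_v | ~~ (m %| z)%N]| = (m.-1 * t)%N.
Proof.
have m0 : (0 < m)%N by rewrite ltnW.
pose i0 := Ordinal m0.
have -> : [set z : 'Z_v | ~~ (m %| z)%N]%SET
    = (vlabel @: (finset.setX (~: [set i0]) [set: 'I_t]))%SET.
  apply/setP => z; rewrite inE; case: vlabel_bij => g gK Kg.
  rewrite -(Kg z) mem_imset; last exact: can_inj gK.
  by rewrite /dvdn vlabel_mod !inE andbT -val_eqE.
rewrite card_imset; last exact: bij_inj vlabel_bij.
by rewrite cardsX cardsC1 cardsT !card_ord.
Qed.

Lemma multipartite_connected : sconnected G.
Proof.
move=> x y; have [xy|xy] := eqVneq x.1 y.1; last exact: connect1.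
have [k kx] : exists k : 'I_m, k != x.1.
  have m0 : (0 < m)%N by rewrite ltnW.
  have [->|ne] := eqVneq x.1 (Ordinal m0).
    by exists (Ordinal m1); rewrite -val_eqE.
  by exists (Ordinal m0); rewrite eq_sym.
apply: (@connect_trans _ _ (k, x.2)); apply: connect1; rewrite /sedge /=.
  by rewrite eq_sym.
by rewrite -xy.
Qed.

Variables (mu : nat) (b : 'I_(2 * mu).+1 -> 'Z_v) (K : 'Z_v).
Hypothesis card_eq : (m.-1 * t = 6 * (2 * mu).+1)%N.
Hypothesis entry_inj : injective (signed (entry b K)).
Hypothesis entry_unmultiple : forall x, ~~ (m %| entry b K x)%N.
Local Notation n := (2 * mu).+1.

Lemma codom_entry z : (z \in codom (signed (entry b K))) = ~~ (m %| z)%N.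
Proof.
have S : codom (signed (entry b K)) \subset [set z : 'Z_v | ~~ (m %| z)%N]%SET.
  apply/fintype.subsetP => _ /codomP[[x c] ->]; rewrite inE /signed /=.
  by case: c; rewrite ?dvdn_Zopp.
have E : #|codom (signed (entry b K))| = #|[set z : 'Z_v | ~~ (m %| z)%N]%SET|.
  rewrite card_unmultiple card_codom // !card_prod card_bool !card_ord card_eq.
  by rewrite (_ : (Zp_trunc 3).+2 = 3)%N //; lia.
by rewrite (subset_cardP E S) inE.
Qed.

(** The two orientations of a triple, indexed by a boolean. *)
Definition sign_turn (s : {ffun 'I_n -> bool}) (i : 'I_n) : 'Z_3 :=
  if s i then 1 else 1 + 1.

Lemma sign_turn_neq0 s i : sign_turn s i != 0.
Proof. by rewrite /sign_turn; case: (s i). Qed.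

(** Each of the 2 ^ n orientations of the rows gives a rotation, and the rotation
    determines the orientation. *)
Lemma exp2_leq_nb_iso_classes :
  (2 ^ n <= nb_iso_classes (@simple_3gonal_biembedding G) * (2 * v ^ 2))%N.
Proof.
have [psi phiK psiK] := vlabel_bij.
have edgeE (x y : G) :
    sedge x y = (vlabel y - vlabel x \in codom (signed (entry b K))).
  by rewrite codom_entry edge_vlabel.
pose T x := psi (vlabel x + 1).
have TE x : vlabel (T x) = vlabel x + 1 by rewrite /T psiK.
have Tbij : bijective T.
  by exists (fun x => psi (vlabel x - 1)) => x; rewrite /T psiK ?addrK ?subrK phiK.
have Tedge x y : sedge (T x) (T y) = sedge x y.
  by rewrite !edgeE !TE opprD addrACA subrr addr0.
pose tau := GIso Tbij Tedge.
have tauX k x : vlabel (iter k tau x) = vlabel x + k%:R.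
  by elim: k => [|k IH]; rewrite ?addr0 //= TE IH -addrA -mulrSr.
have Ttrans (x y : G) : exists k, y = iter k tau x.
  exists (vlabel y - vlabel x : 'Z_v); apply: (can_inj phiK).
  by rewrite tauX natr_Zp addrC subrK.
pose wc s := cid (unicellular (sign_turn_neq0 s)).
pose rho s := drot phiK psiK entry_inj edgeE (row_turn (sign_turn s))
  (turn (sval (wc s))).
have rho_inj : injective rho.
  move=> s s' E; apply/ffunP => r.
  have ss : sign_turn s r = sign_turn s' r.
    pose x : 'I_n * 'Z_3 := (r, 1 + 1).
    have xr : cell_row x = r by exact: addr0.
    pose y := psi (signed (entry b K) (x, false)).
    have xy : sedge (psi 0 : G) y by rewrite edgeE !psiK subr0 codom_f.
    pose d : dart G := exist (fun d : G * G => sedge d.1 d.2) (psi 0, y) xy.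
    have := congr1 (fun f : {perm dart G} => vlabel (sval (f d)).2) E.
    rewrite /rho !drotE /= !vrotE.
    rewrite /dhead /dtail /= !psiK subr0 => /addrI.
    rewrite !rot0E /= => /entry_inj [] /(congr1 (to_row _)).
    rewrite !row_turn_row xr => /pair_equal_spec[_]; exact: addrI.
  by move: ss; rewrite /sign_turn; case: (s r); case: (s' r).
have x0 : 'I_t := Ordinal t0.
have xy0 : sedge ((Ordinal (ltnW m1), x0) : G) ((Ordinal m1, x0) : G) by [].
pose d0 : dart G :=
  exist (fun d : G * G => sedge d.1 d.2) ((_ : G), (_ : G)) xy0.
have <- : #|[set rho s | s in {ffun 'I_n -> bool}]%SET| = (2 ^ n)%N.
  by rewrite card_imset // card_ffun card_bool card_ord.
apply: leq_trans (leq_nb_iso_classes (T := tau)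
  (P := @simple_3gonal_biembedding G) d0 Ttrans _ _) _.
- by move=> r [].
- move=> _ /imsetP[s _ ->]; split.
    move=> d; apply: dart_ext.
      by rewrite -[LHS]/(tau (dtail (rho s d))) /rho !drot_tail.
    rewrite -[LHS]/(tau (dhead (rho s d))) /rho !drot_head.
    apply: (can_inj phiK); rewrite [LHS]TE !vrotE.
    rewrite -[dtail (giso_dart _ _)]/(T (dtail d)).
    rewrite -[dhead (giso_dart _ _)]/(T (dhead d)).
    by rewrite !TE opprD addrACA subrr addr0 addrAC.
  apply: drot_biembedding3; last exact: multipartite_connected.
  + exact/zero_sum_turn_row/sign_turn_neq0.
  + by apply: zero_sum_turn_turn; case: (svalP (wc s)).
  by case: (svalP (wc s)).
rewrite leq_mul2l leq_mul2l /=; apply/orP; right.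
apply: leq_trans (leq_card sval val_inj) _.
by rewrite !card_prod !card_ord.
Qed.
End CompleteMultipartite.

(** * Arrays of integers *)

Section IntegerArrays.
Variables (m t mu : nat) (beta : nat -> int) (kappa : int).
Hypotheses (m1 : (1 < m)%N) (t0 : (0 < t)%N).
Hypothesis mu0 : (0 < mu)%N.
Hypothesis card_eq : (m.-1 * t = 6 * (2 * mu).+1)%N.
Local Notation v := (m * t)%N.
Local Notation n := (2 * mu).+1.
Local Open Scope ring_scope.

(** The integer version of [entry], with natural numbers as indices. *)
Definition int_entry (j q : nat) : int :=
  let b0 := beta (if j is j'.+1 then j' else 2 * mu)%N in
  if q == 0%N then b0 else if q == 1%N then beta j + kappa
  else - (b0 + beta j + kappa).

Let v1 : (1 < v)%N. Proof. by rewrite (leq_trans m1) // leq_pmulr. Qed.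

Lemma intr_Zp_mod (z : int) : (m %| (z%:~R : 'Z_v))%N = (m%:Z %| z)%Z.
Proof.
have H k : (m %| (k%:R : 'Z_v))%N = (m %| k)%N.
  by rewrite /dvdn val_Zp_nat // modn_dvdm // dvdn_mulr.
by case: z => k; rewrite ?NegzE ?mulrNz ?(dvdn_Zopp m1 t0) H ?dvdzE ?abszN.
Qed.

Lemma intr_Zp_eq0 (z : int) : ((z%:~R : 'Z_v) == 0) = (v%:Z %| z)%Z.
Proof.
have H k : ((k%:R : 'Z_v) == 0) = (v %| k)%N.
  by rewrite -val_eqE /= val_Zp_nat.
by case: z => k; rewrite ?NegzE ?mulrNz ?oppr_eq0 H ?dvdzE ?abszN.
Qed.

Hypothesis ientry_sub : forall j q j' q', (j < n)%N -> (q < 3)%N -> (j' < n)%N ->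
  (q' < 3)%N -> (v%:Z %| int_entry j q - int_entry j' q')%Z -> j = j' /\ q = q'.
Hypothesis ientry_add : forall j q j' q', (j < n)%N -> (q < 3)%N -> (j' < n)%N ->
  (q' < 3)%N -> ~ (v%:Z %| int_entry j q + int_entry j' q')%Z.
Hypothesis ientry_mod : forall j q, (j < n)%N -> (q < 3)%N ->
  ~ (m%:Z %| int_entry j q)%Z.

Lemma entry_intr (x : 'I_n * 'Z_3) :
  entry (fun j : 'I_n => (beta j)%:~R : 'Z_v) kappa%:~R x = (int_entry x.1 x.2)%:~R.
Proof.
case: x => j q; rewrite /entry /int_entry /=.
set b0 := (X in (beta X)%:~R); set b1 := (X in if _ then (beta X) else _).
have -> : b0 = b1.
  rewrite /b0 /b1 (modn_small (_ : 1 < n)%N); last lia.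
  rewrite (modn_small (_ : n - 1 < n)%N); last lia.
  case: j {b0 b1} => [[|j] jn] /=; first by rewrite modn_small; lia.
  by rewrite (_ : j.+1 + (n - 1) = j + n)%N ?modnDr ?modn_small; lia.
by case: ifP => // _; case: ifP => _; rewrite ?rmorphN ?rmorphD.
Qed.

Lemma int_array_bound :
  (2 ^ n <= nb_iso_classes
     (@simple_3gonal_biembedding (complete_multipartite m t)) * (2 * v ^ 2))%N.
Proof.
apply: (@exp2_leq_nb_iso_classes m t m1 t0 mu
  (fun j : 'I_n => (beta j)%:~R) kappa%:~R card_eq).
  have sub (x y : 'I_n * 'Z_3) :
      (int_entry x.1 x.2)%:~R = (int_entry y.1 y.2)%:~R :> 'Z_v -> x = y.
    move/eqP; rewrite -subr_eq0 -rmorphB intr_Zp_eq0.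
    case/(ientry_sub (ltn_ord x.1) (ltn_ord x.2) (ltn_ord y.1) (ltn_ord y.2)).
    move=> E1 E2.
    by rewrite [x]surjective_pairing [y]surjective_pairing (val_inj E1) (val_inj E2).
  have add (x y : 'I_n * 'Z_3) :
      (int_entry x.1 x.2)%:~R = - (int_entry y.1 y.2)%:~R :> 'Z_v -> False.
    move/eqP; rewrite -addr_eq0 -rmorphD intr_Zp_eq0.
    exact: ientry_add (ltn_ord x.1) (ltn_ord x.2) (ltn_ord y.1) (ltn_ord y.2).
  move=> [x c] [y c']; rewrite /signed /= !entry_intr.
  case: c; case: c' => E.
  - by rewrite (sub _ _ (oppr_inj E)).
  - by case: (add _ _ (esym E)).
  - by case: (add _ _ E).
  by rewrite (sub _ _ E).
move=> x; rewrite entry_intr intr_Zp_mod; apply/negP; exact: ientry_mod.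
Qed.

End IntegerArrays.

Lemma dvdz_small (v : nat) (z : int) : (v%:Z %| z)%Z -> `|z|%N < v -> z = 0%R.
Proof.
rewrite dvdzE => vz zv; apply/eqP; rewrite -absz_eq0 -leqn0 leqNgt.
by apply/negP => z0; have := dvdn_leq z0 vz; rewrite leqNgt zv.
Qed.

Lemma half_cases i : exists h, i./2 = h /\
  (odd i = false /\ i = 2 * h \/ odd i = true /\ i = 2 * h + 1).
Proof.
exists i./2; split=> //; have := odd_double_half i.
by case: (odd i) => /= E; [right|left]; split=> //; lia.
Qed.

(** The case of t = 1, 2 ([r] = 0, n = 4 k + 1) and t = 3 ([r] = 1, n = 4 k + 3).
    The absolute values of the entries are 1, ..., 3 n + r, without 2 n + 1 if
    [r] = 1. *)
Section FourQuarters.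
Variables k r : nat.
Hypotheses (r1 : r <= 1) (kr0 : 0 < 2 * k + r).
Local Notation mu := (2 * k + r).
Local Notation n := (2 * mu).+1.

(** The opposite of the sequence b. It consists of four monotone runs of
    consecutive numbers, two on the even and two on the odd indices. Up to sign,
    the values of b and of b + K fill the numbers from n + 1 to 3 n + r, except
    2 n + 1 if [r] = 1. The runs on even and on odd indices increase or decrease
    together, up to a shift at the breaks, so that the sums b_(j-1) + b_j + K
    run through 1, ..., n up to sign. *)
Definition quarters (i : nat) : nat :=
  if odd i then
    if i./2 < k + r then 8 * k + 4 * r + 2 - i./2 else 8 * k + 5 * r + 3 + i./2
  else if i./2 <= k then 12 * k + 7 * r + 3 - i./2 else 4 * k + 2 * r + 2 + i./2.

(** The graph of [quarters], in a form suited to linear arithmetic. *)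
Definition quarters_spec (i B : nat) : Prop := exists h : nat,
  [\/ i = 2 * h + 1 /\ h < k + r /\ B + h = 8 * k + 4 * r + 2,
      i = 2 * h + 1 /\ k + r <= h /\ B = 8 * k + 5 * r + 3 + h,
      i = 2 * h /\ h <= k /\ B + h = 12 * k + 7 * r + 3
    | i = 2 * h /\ k < h /\ B = 4 * k + 2 * r + 2 + h].

Lemma quartersP i : quarters_spec i (quarters i).
Proof.
rewrite /quarters; have [h [-> [[-> ->]|[-> ->]]]] := half_cases i; exists h.
  by case: ifP => hk; [constructor 3|constructor 4]; lia.
by case: ifP => hk; [constructor 1|constructor 2]; lia.
Qed.

Local Notation beta := (fun i => - (quarters i)%:Z)%R.
Local Notation kappa := ((16 * k + 9 * r + 5)%N%:Z)%R.
Local Notation qentry := (int_entry mu beta kappa).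

(** The entries, the sums being evaluated: in absolute value the third entry of
    column [j] is [n - j], except that the values at [0] and [mu + 1] are
    exchanged. *)
Definition qentry_spec (j q : nat) (e : int) : Prop :=
  if q == 0 then exists p B, [/\ p < n, quarters_spec p B,
    (j = 0 /\ p = 2 * mu) \/ j = p + 1 & e = (- B%:Z)%R]
  else if q == 1 then exists B, quarters_spec j B /\ e = (kappa - B%:Z)%R
  else [\/ j = 0 /\ e = mu%:Z%R, j = mu + 1 /\ (e = n%:Z \/ e = - n%:Z)%R,
    1 <= j <= mu /\ e = (n - j)%N%:Z%R
  | mu + 2 <= j /\ e = (- (n - j)%N%:Z)%R].

Lemma qentryP j q : j < n -> q < 3 -> qentry_spec j q (qentry j q).
Proof.
move=> jn; case: q => [|[|[|//]]] _; rewrite /qentry_spec /int_entry /=.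
- case: j jn => [|j] jn.
    by exists (2 * mu), (quarters (2 * mu)); split=> //; [exact: quartersP | left].
  by exists j, (quarters j); split=> //; [lia | exact: quartersP | right; lia].
- by exists (quarters j); split; [exact: quartersP | lia].
have := quartersP (if j is j'.+1 then j' else 2 * mu); move: (quarters _) => B0.
have := quartersP j; move: (quarters j) => B PB P0.
case: j jn P0 PB => [|j] jn [h0 P0] [h PB].
  by constructor 1; case: P0 => -[? []] ? ?; case: PB => -[? []] ? ?; lia.
have [j1|j1|j1] := ltngtP j mu; [constructor 3|constructor 4|constructor 2];
  case: P0 => -[? []] ? ?; case: PB => -[? []] ? ?; lia.
Qed.

Lemma qentry_spec_inj j q e j' q' e' : j < n -> q < 3 -> j' < n -> q' < 3 ->
  qentry_spec j q e -> qentry_spec j' q' e' -> e = e' \/ e = (- e')%R ->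
  j = j' /\ q = q'.
Proof.
move=> jn qn j'n q'n; case: q qn => [|[|[|//]]] _; case: q' q'n => [|[|[|//]]] _;
  rewrite /qentry_spec /quarters_spec /=.
- move=> [p [B [pn [h C] D ->]]] [p' [B' [p'n [h' C'] D' ->]]] EE.
  by case: C => -[? [? ?]]; case: C' => -[? [? ?]]; split; lia.
- move=> [p [B [pn [h C] D ->]]] [B' [[h' C'] ->]] EE; exfalso.
  by case: C => -[? [? ?]]; case: C' => -[? [? ?]]; lia.
- move=> [p [B [pn [h C] D ->]]] C' EE; exfalso.
  by case: C => -[? [? ?]]; case: C' => -[? ?]; lia.
- move=> [B [[h C] ->]] [p' [B' [p'n [h' C'] D' ->]]] EE; exfalso.
  by case: C => -[? [? ?]]; case: C' => -[? [? ?]]; lia.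
- move=> [B [[h C] ->]] [B' [[h' C'] ->]] EE.
  by case: C => -[? [? ?]]; case: C' => -[? [? ?]]; split; lia.
- move=> [B [[h C] ->]] C' EE; exfalso.
  by case: C => -[? [? ?]]; case: C' => -[? ?]; lia.
- move=> C' [p [B [pn [h C] D ->]]] EE; exfalso.
  by case: C => -[? [? ?]]; case: C' => -[? ?]; lia.
- move=> C' [B [[h C] ->]] EE; exfalso.
  by case: C => -[? [? ?]]; case: C' => -[? ?]; lia.
by move=> C C' EE; case: C => -[? ?]; case: C' => -[? ?]; split; lia.
Qed.

Lemma qentry_bounds j q : j < n -> q < 3 ->
  [/\ qentry j q <> 0%R, `|qentry j q|%N <= 3 * n + r
    & r = 1 -> `|qentry j q|%N <> 2 * n + 1].
Proof.
move=> jn qn; have := qentryP jn qn; move: (qentry j q) => e.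
case: q qn => [|[|[|//]]] _; rewrite /qentry_spec /quarters_spec /=.
- move=> [p [B [pn [h C] D ->]]].
  by case: C => -[? [? ?]]; split; lia.
- move=> [B [[h C] ->]].
  by case: C => -[? [? ?]]; split; lia.
by case=> -[? ?]; split; lia.
Qed.

Lemma quarters_bound m t : 1 < m -> 0 < t -> m.-1 * t = 6 * n ->
  2 * (3 * n + r) < m * t ->
  (forall z : int, z <> 0%R -> `|z|%N <= 3 * n + r ->
     (r = 1 -> `|z|%N <> 2 * n + 1) -> ~ (m%:Z %| z)%Z) ->
  2 ^ n <= nb_iso_classes
     (@simple_3gonal_biembedding (complete_multipartite m t)) * (2 * (m * t) ^ 2).
Proof.
move=> m1 t0 card v_gt m_ndvd.
apply: (@int_array_bound m t mu beta kappa) => //.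
- move=> j q j' q' jn qn j'n q'n /dvdz_small E.
  have [_ b _] := qentry_bounds jn qn; have [_ b' _] := qentry_bounds j'n q'n.
  apply: (qentry_spec_inj jn qn j'n q'n (qentryP jn qn) (qentryP j'n q'n)).
  left; apply/eqP; rewrite -GRing.subr_eq0; apply/eqP/E; lia.
- move=> j q j' q' jn qn j'n q'n /dvdz_small E.
  have [nz b _] := qentry_bounds jn qn; have [_ b' _] := qentry_bounds j'n q'n.
  have {}E : qentry j q = (- qentry j' q')%R.
    by apply/eqP; rewrite -GRing.addr_eq0; apply/eqP/E; lia.
  have [jj qq] := qentry_spec_inj jn qn j'n q'n (qentryP jn qn)
    (qentryP j'n q'n) (or_intror E).
  by apply: nz; move: E; rewrite -jj -qq; lia.
by move=> j q jn qn; have [? ? ?] := qentry_bounds jn qn; exact: m_ndvd.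
Qed.

End FourQuarters.

(** The case of t = n and t = 2 n, where v is [c * n] with [c] = 7, 8. The entries
    at positions 0, 1, 2 are 1, 2 and -3 modulo [c]; as n is odd, j |-> 2 j is
    injective modulo n, so the entries of each kind are distinct modulo v. *)
Section ArithmeticProgressions.
Variables (mu c m t : nat).
Local Notation n := (2 * mu).+1.
Hypothesis mu0 : 0 < mu.
Hypothesis cmt : [/\ c = 7, m = 7 & t = n] \/ [/\ c = 8, m = 4 & t = 2 * n].

Local Notation pentry := (int_entry mu (fun i => (c * i + 1)%N%:Z)%R 1%R).

Let c78 : c = 7 \/ c = 8. Proof. by case: cmt => -[-> _ _]; [left|right]. Qed.

(** The entries, with [p] the column preceding [j] in the cyclic order. *)
Definition pentry_spec (j q : nat) (e : int) : Prop := exists p : nat,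
  [/\ p < n, (j = 0 /\ p = 2 * mu) \/ j = p + 1 &
  if q == 0 then e = (c * p + 1)%N%:Z%R else if q == 1 then e = (c * j + 2)%N%:Z%R
  else e = (- (c * (p + j) + 3)%N%:Z)%R].

Lemma pentryP j q : j < n -> q < 3 -> pentry_spec j q (pentry j q).
Proof.
move=> jn; case: q => [|[|[|//]]] _; rewrite /pentry_spec /int_entry /=;
  case: j jn => [|j] jn; [exists (2 * mu) | exists j | exists (2 * mu) | exists j
    | exists (2 * mu) | exists j]; split; case: c78 => E; rewrite ?E; lia.
Qed.

Lemma arithmetic_bound :
  2 ^ n <= nb_iso_classes
     (@simple_3gonal_biembedding (complete_multipartite m t)) * (2 * (m * t) ^ 2).
Proof.
have ct : m * t = c * n by case: cmt => -[-> -> ->] //; lia.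
have dvd (z : int) : ((m * t)%N%:Z %| z)%Z -> exists w : int, z = (c%:Z * (w * n%:Z))%R.
  by case/dvdzP => w ->; exists w; rewrite ct; lia.
have small (w : int) : `|(w * n%:Z)%R|%N < 2 * n -> [\/ w = 0, w = 1 | w = - 1]%R.
  rewrite abszM ltn_mul2r => /andP[_ w2].
  have [w0|[w0|w0]] : w = 0%R \/ w = 1%R \/ w = (- 1)%R by lia.
  - by constructor 1.
  - by constructor 2.
  by constructor 3.
have X0 (w X : int) : X = (w * n%:Z)%R -> `|X|%N < 2 * n ->
    [\/ X = 0, X = n%:Z | X = - n%:Z]%R.
  move=> -> /small[]->; [constructor 1|constructor 2|constructor 3]; lia.
apply: (@int_array_bound m t mu (fun i => (c * i + 1)%N%:Z)%R 1%R) => //;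
  try by case: cmt => -[E1 E2 E3]; rewrite ?E2 ?E3; lia.
- move=> j q j' q' jn qn j'n q'n.
  have := pentryP jn qn; have := pentryP j'n q'n.
  move: (pentry j q) (pentry j' q') => e e' [p' [p'n pj' ep']] [p [pn pj ep]] /dvd[w].
  move: (X0 w); move: (w * n%:Z)%R => X /(_ X erefl) XP.
  by case: q qn ep => [|[|[|//]]] _ /= ->; case: q' q'n ep' => [|[|[|//]]] _ /= ->;
    case: c78 => -> E; try (by exfalso; lia); split=> //; case: XP; lia.
- move=> j q j' q' jn qn j'n q'n.
  have := pentryP jn qn; have := pentryP j'n q'n.
  move: (pentry j q) (pentry j' q') => e e' [p' [p'n pj' ep']] [p [pn pj ep]] /dvd[w].
  move: (w * n%:Z)%R => X.
  by case: q qn ep => [|[|[|//]]] _ /= ->; case: q' q'n ep' => [|[|[|//]]] _ /= ->;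
    case: c78 => -> E; lia.
move=> j q jn qn; have := pentryP jn qn; move: (pentry j q) => e [p [pn pj ep]].
case/dvdzP => w; case: cmt => -[-> -> _] in ep *;
  by case: q qn ep => [|[|[|//]]] _ /= ->; lia.
Qed.

End ArithmeticProgressions.

(** * The lower bound and its growth *)

Section Asymptotic.
Variable R : realType.
Local Open Scope ring_scope.
Local Open Scope classical_set_scope.

Lemma lower_bound_expR n : (0 < n)%N ->
  lower_bound R n = expR (n%:R / 2 * ln 2 - ln (9 * n%:R ^+ 2)).
Proof.
move=> n0; have p : 0 < 9 * n%:R ^+ 2 :> R by rewrite mulr_gt0 // exprn_gt0 // ltr0n.
by rewrite /lower_bound /powR pnatr_eq0 /= expRD expRN lnK // posrE.
Qed.

Lemma ln_natr_bound (d C : R) : 0 < d ->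
  \forall w \near \oo, C + ln (9 * w%:R ^+ 2) <= d * w%:R.
Proof.
move=> d0; pose r := d / 12; have r0 : 0 < r by rewrite divr_gt0.
(* ln y < y is applied to y = 3 w r, so that ln (3 w) < 3 w r - ln r. *)
near=> w.
have w0 : 0 < w%:R :> R by rewrite ltr0n; near: w; exact: nbhs_infty_gt.
have rw0 : 0 < 3 * w%:R * r by rewrite mulr_gt0 // mulr_gt0.
have w3 : 0 < 3 * w%:R :> R by rewrite mulr_gt0.
have -> : 9 * w%:R ^+ 2 = (3 * w%:R) ^+ 2 :> R by ring.
rewrite lnXn // (_ : 3 * w%:R = 3 * w%:R * r / r); last by rewrite mulfK ?gt_eqF.
rewrite ln_div ?posrE //.
have L := ln_sublinear rw0.
have big : (C - 2 * ln r) * 2 / d <= w%:R by near: w; exact: nbhs_infty_ger.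
move: big; rewrite ler_pdivrMr // => big.
have rE : r * 12 = d by rewrite /r divfK // pnatr_eq0.
rewrite mulr2n; nra.
Unshelve. all: by end_near. Qed.

Lemma equiv_exp2_lower_bound (a t : nat) : (0 < a)%N ->
  equiv_exp2 (lower_bound R) (fun n => a * n + t)%N (2 * a)%N%:R.
Proof.
move=> a0; have a0' : 0 < a%:R :> R by rewrite ltr0n.
have l2 : 0 < ln 2 :> R by rewrite ln_gt0 // ltr1n.
pose x (w : nat) : R := (w%:R - t%:R) / a%:R.
(* The exponent is exactly n / 2 - log2 (9 n ^ 2), with n = (w - t) / a. *)
pose e (w : nat) : R := - (t%:R / (2 * a)%N%:R) - ln (9 * x w ^+ 2) / ln 2.
exists e; split.
  apply/eqoP => d d0.
  have := @ln_natr_bound (d * ln 2) (t%:R / (2 * a)%N%:R * ln 2) (mulr_gt0 d0 l2).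
  apply: filter_app; near=> w => H.
  have wt : (t + a <= w)%N by near: w; exact: nbhs_infty_ge.
  have x1 : 1 <= x w.
    rewrite /x ler_pdivlMr // mul1r lerBrDl -natrD ler_nat //.
  have xw : x w <= w%:R.
    rewrite /x ler_pdivrMr //; have a1 : 1 <= a%:R :> R by rewrite ler1n.
    have : 0 <= w%:R :> R by []. have : 0 <= t%:R :> R by []. nra.
  have L0 : 0 <= ln (9 * x w ^+ 2) by rewrite ln_ge0 //; nra.
  have L1 : ln (9 * x w ^+ 2) <= ln (9 * w%:R ^+ 2).
    by rewrite ler_ln ?posrE; nra.
  have T0 : 0 <= t%:R / (2 * a)%N%:R :> R by rewrite divr_ge0.
  rewrite /e -opprD normrN ger0_norm; last by rewrite addr_ge0 // divr_ge0 // ltW.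
  rewrite [`|_%:R|]ger0_norm // -(ler_pM2r l2) mulrDl divfK ?gt_eqF //.
  by rewrite [d * _ * _]mulrAC; apply: le_trans H; rewrite lerD2l.
apply: cvg_near_cst; near=> n.
have n0 : (0 < n)%N by near: n; exact: nbhs_infty_gt.
have xE : x (a * n + t)%N = n%:R.
  by rewrite /x natrD addrK natrM mulrC mulKf ?gt_eqF.
rewrite lower_bound_expR //.
have -> : 2 `^ ((a * n + t)%N%:R / (2 * a)%N%:R + e (a * n + t)%N)
    = expR (n%:R / 2 * ln 2 - ln (9 * n%:R ^+ 2)) :> R.
  rewrite /powR pnatr_eq0 /=; congr expR.
  by rewrite /e xE natrD !natrM; field; rewrite ?gt_eqF.
by rewrite divff // gt_eqF // expR_gt0.
Unshelve. all: by end_near. Qed.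

Lemma lower_bound_count n v N : (3 <= n)%N -> (v <= 8 * n)%N ->
  (2 ^ n <= N * (2 * v ^ 2))%N -> lower_bound R n <= N%:R.
Proof.
move=> n3 vn H.
have N0 : (0 < N)%N by case: N H => //; rewrite mul0n leqn0 expn_eq0.
have n0 : 0 < n%:R :> R by rewrite ltr0n; lia.
rewrite /lower_bound ler_pdivrMr; last by rewrite mulr_gt0 // exprn_gt0.
set s := 2 `^ _.
have s0 : 0 < s by exact: powR_gt0.
have p4 : 2 `^ 4 = 16 :> R by rewrite powR_mulrn // -natrX.
have N1 : 1 <= N%:R :> R by rewrite ler1n.
have n3' : 3 <= n%:R :> R by rewrite ler_nat.
(* With s = 2 ^ (n / 2), either n < 8 and s <= 16 < 9 n ^ 2, or n >= 8 and
   16 s <= s ^ 2 <= 128 n ^ 2 N. *)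
have [n8|n8] := ltnP n 8.
  have s16 : s <= 16.
    rewrite -p4; apply: ler_powR; first by rewrite ler1n.
    have : n%:R < 8 :> R by rewrite ltr_nat. lra.
  have : 81 <= 9 * n%:R ^+ 2 :> R by nra.
  by move=> ?; nra.
have s16 : 16 <= s.
  rewrite -p4; apply: ler_powR; first by rewrite ler1n.
  have : 8 <= n%:R :> R by rewrite ler_nat. lra.
have ss : s * s = 2 ^+ n.
  rewrite /s -powRD; last by rewrite pnatr_eq0 implybT.
  by rewrite -splitr powR_mulrn.
have H' : (2 ^ n <= N * (2 * (8 * n) ^ 2))%N.
  by apply: leq_trans H _; rewrite leq_mul2l leq_mul2l leq_sqr vn !orbT.
have : s * s <= N%:R * (2 * (8 * n%:R) ^+ 2).
  by rewrite ss -natrX -!natrM -natrX -!natrM ler_nat.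
have : s * 16 <= s * s by rewrite ler_pM2l.
have : 0 <= N%:R * n%:R ^+ 2 :> R by rewrite mulr_ge0 // exprn_ge0.
move=> q1 q2 q3; nra.
Qed.

End Asymptotic.

Local Open Scope ring_scope.

Theorem theorem5p9 (R : realType) :
  (forall n t : nat, (3 <= n)%N -> admissible n t ->
     lower_bound R n <=
       (nb_iso_classes
          (@simple_3gonal_biembedding
             (complete_multipartite ((6 * n + t) %/ t) t)))%:R :> R) /\
  [/\ forall t : nat, [\/ t = 1%N, t = 2%N | t = 3%N] ->
        equiv_exp2 (lower_bound R) (fun n => (6 * n + t)%N) 12,
      equiv_exp2 (lower_bound R) (fun n => (6 * n + n)%N) 14
    & equiv_exp2 (lower_bound R) (fun n => (6 * n + 2 * n)%N) 16].
Proof.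
split; last first.
  split.
  - by move=> t _; exact: (@equiv_exp2_lower_bound R 6 t).
  - have -> : (fun n => 6 * n + n)%N = (fun n => 7 * n + 0)%N.
      by apply/funext => n; lia.
    exact: (@equiv_exp2_lower_bound R 7 0).
  have -> : (fun n => 6 * n + 2 * n)%N = (fun n => 8 * n + 0)%N.
    by apply/funext => n; lia.
  exact: (@equiv_exp2_lower_bound R 8 0).
move=> n t n3 adm.
suff [m [mE mt H]] : exists m, [/\ (6 * n + t = m * t)%N, (0 < t)%N &
    (2 ^ n <= nb_iso_classes (@simple_3gonal_biembedding (complete_multipartite m t))
      * (2 * (m * t) ^ 2))%N].
  rewrite mE mulnK //; apply: (@lower_bound_count R n (m * t)%N _ n3 _ H).
  by rewrite -mE; case: adm => -[]; lia.
have ndvd (m : nat) (z : int) : z <> 0 -> (`|z|%N < m)%N -> ~ (m%:Z %| z)%Z.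
  by move=> z0 zm /dvdz_small-/(_ zm).
case: adm => [[t12 n1]|[t3 n4]|[tn on]].
- have [k nE] : exists k, n = (2 * (2 * k + 0)).+1 by exists (n %/ 4)%N; lia.
  have [m mE] : exists m, (6 * n + t = m * t)%N /\ (3 * n < m)%N.
    by case: t12 => ->; [exists (6 * n + 1)%N | exists (3 * n + 1)%N]; lia.
  exists m; split; [lia | by case: t12 => -> | rewrite {1}nE].
  apply: (@quarters_bound k 0) => //; rewrite -?nE.
  + lia.
  + lia.
  + by case: t12 => ->.
  + by case: t12 mE => -> [mE _]; lia.
  + by case: t12 mE => -> [mE _]; lia.
  by move=> z z0 zn _; apply: ndvd => //; lia.
- have [k nE] : exists k, n = (2 * (2 * k + 1)).+1 by exists (n %/ 4)%N; lia.
  exists (2 * n + 1)%N; rewrite t3; split=> //; [lia | rewrite {1}nE].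
  apply: (@quarters_bound k 1) => //; rewrite -?nE; try lia.
  move=> z z0 zn /(_ erefl) zm; rewrite dvdzE absz_nat => /dvdnP[q].
  case: q => [|[|q]]; rewrite ?mulSn; lia.
have [mu nE] : exists mu, n = (2 * mu).+1.
  by exists n./2; have := odd_double_half n; rewrite on; lia.
have mu0 : (0 < mu)%N by lia.
case: tn => tE; [exists 7%N | exists 4%N]; split; try lia; rewrite {1}nE.
  by apply: (@arithmetic_bound mu 7) => //; left; rewrite -nE.
by apply: (@arithmetic_bound mu 8) => //; right; rewrite -nE.
Qed.
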